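(* Let $\mathcal{Y}=\{y_1,\dots,y_n\}\subset[-\pi,\pi)^d$ be a fixed set of $n$ distinct nodes, and let $m=\mu(\mathcal{Y})$ be its discrete moment order. For a positive integer $N$ and $0<\Delta<\frac1{2\pi}$ let $\mathcal{X}=\Delta\mathcal{Y}$ and let $D_N=D_N(\mathcal{X})$ be the normalized Dirichlet kernel matrix of $\mathcal{X}$. Then for every $\epsilon_0>0$ and $\alpha\in(0,1)$ there exists $N_0$ such that for all $N\ge N_0$ and $\alpha\epsilon_0<N\Delta<\epsilon_0$, the eigenvalues of $D_N$ split into $m+1$ groups $$\lambda_{0,0}(D_N)\asymp(N\Delta)^0,\quad \{\lambda_{1,j}(D_N)\}_{j=1}^{t_1}\asymp(N\Delta)^2,\ \dots,\ \{\lambda_{m,j}(D_N)\}_{j=1}^{t_m}\asymp(N\Delta)^{2m},$$ where $t_k:=\operatorname{rank}(V_{\leq k}(\mathcal{X}))-\operatorname{rank}(V_{\leq k-1}(\mathcal{X}))$ for $k=1,\dots,m$. Here $\asymp$ means ''exact scaling'', as defined in the context.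
   Context: For a finite set $\mathcal{A}\subset\mathbb{R}^d$ and an integer $k\ge0$, $V_{\leq k}(\mathcal{A})=[a^{\alpha}]_{a\in\mathcal{A},\ |\alpha|\le k}$ is the matrix with rows indexed by the points of $\mathcal{A}$ and columns indexed by all multi-indices $\alpha\in\mathbb{Z}_+^d$ with $|\alpha|\le k$. The discrete moment order $\mu(\mathcal{Y})$ of a set of $n$ distinct points is the smallest integer $m$ with $\operatorname{rank}(V_{\leq m}(\mathcal{Y}))=n$; it satisfies $\mu(\Delta\mathcal{Y})=\mu(\mathcal{Y})$. Let $\mathcal{G}_N=\{0,\pm1,\dots,\pm N\}^d$ and $$D_N(\mathcal{X})=\frac1{(2N)^d}\Big[\sum_{\omega\in\mathcal{G}_N}\exp(\imath\langle x-x',\omega\rangle)\Big]_{x,x'\in\mathcal{X}}=\frac{1}{(2N)^d}U^*U,\qquad U=[\exp(\imath\langle\omega,x\rangle)]_{\omega\in\mathcal{G}_N,\ x\in\mathcal{X}}.$$ With $\epsilon:=N\Delta$, ''exact scaling'' $\lambda_{k,j}\asymp\epsilon^{2k}$ means that there exists a constant $\tilde\lambda_{k,j}\ne0$ independent of $\epsilon$ such that $\lambda_{k,j}=\epsilon^{2k}(\tilde\lambda_{k,j}+O(\epsilon))$. *)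

(* Defs.v *)
From HB Require Import structures.
From mathcomp Require Export all_boot all_order all_algebra.
From mathcomp Require Export complex.
From mathcomp Require Export reals trigo.

Set Implicit Arguments.
Unset Strict Implicit.
Unset Printing Implicit Defensive.

Import Order.TTheory GRing.Theory Num.Theory.
Local Open Scope ring_scope.
Local Open Scope complex_scope.

Definition multi_index (d k : nat) : {set {ffun 'I_d -> 'I_k.+1}} :=
  [set a : {ffun 'I_d -> 'I_k.+1} | (\sum_(i < d) a i <= k)%N].

Definition vandermonde_le (R : realType) (d n : nat) (x : 'I_n -> 'rV[R]_d)
    (k : nat) : 'M[R]_(n, #|multi_index d k|) :=
  \matrix_(p, c) \prod_(i < d)
    x p 0 i ^+ (enum_val c : {ffun 'I_d -> 'I_k.+1}) i.

Definition is_discrete_moment_order (R : realType) (d n : nat)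
    (y : 'I_n -> 'rV[R]_d) (m : nat) : Prop :=
  \rank (vandermonde_le y m) = n /\
  (forall k, \rank (vandermonde_le y k) = n -> (m <= k)%N).

Definition scaled (R : realType) (d n : nat) (Delta : R)
    (y : 'I_n -> 'rV[R]_d) : 'I_n -> 'rV[R]_d :=
  fun p => Delta *: y p.

(* Used for k >= 1 only; there is no matrix of degree k - 1 when k = 0. *)
Definition rank_increment (R : realType) (d n : nat) (x : 'I_n -> 'rV[R]_d)
    (k : nat) : nat :=
  (\rank (vandermonde_le x k) - \rank (vandermonde_le x k.-1))%N.

Definition expi (R : realType) (t : R) : R[i] := cos t +i* sin t.

(* The grid {0, ±1, ..., ±N}^d is indexed by functions g : 'I_d -> {0, ..., 2N};
   the frequency of g has coordinates g i - N. *)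
Definition grid_freq (R : realType) (d N : nat)
    (g : {ffun 'I_d -> 'I_(2 * N).+1}) : 'rV[R]_d :=
  \row_i ((g i)%:R - N%:R).

Definition dotv (R : realType) (d : nat) (u v : 'rV[R]_d) : R :=
  \sum_(i < d) u 0 i * v 0 i.

Definition dirichlet_matrix (R : realType) (d n N : nat)
    (x : 'I_n -> 'rV[R]_d) : 'M[R[i]]_n :=
  \matrix_(p, q) (((2 * N) ^ d)%N%:R^-1 *
    \sum_(g : {ffun 'I_d -> 'I_(2 * N).+1})
       expi (dotv (x p - x q) (grid_freq R g))).

(* lambda = eps^(2k) (ltilde + O(eps)), where C is the constant in O(eps). *)
Definition scales_with (R : realType) (ltilde C eps : R) (k : nat) (lambda : R)
    : Prop :=
  exists r : R, `|r| <= C * eps /\ lambda = eps ^+ (2 * k) * (ltilde + r).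

(* Main.v *)
Require Import Defs.
From mathcomp Require Import spectral sesquilinear perm ring lra zify polyrcf.
From mathcomp Require Import classical_sets set_interval topology normedtype.
From mathcomp Require Import derive realfun.

(** Why the theorem holds. Put eps = N Delta and, for a frequency omega of the grid,
    tau = omega / N in [-1, 1]^d. The row of U at omega has entries exp(i eps <tau, y_s>), and
    D_N is, up to normalization, the mean over the grid of the rank one matrices formed from
    these rows. Their Taylor coefficients of degree k in eps are combinations of the
    columns of degree k of the Vandermonde matrix of Y.

    Choose an orthonormal basis adapted to the flag of the column spaces of V_{<= k}
    ([flag_basis]); t_k of its vectors have level k, that is, lie in the k-th space and are
    orthogonal to the previous one. Such a vector annihilates the Taylor terms of degree below
    k, so its product with a wave is eps^k (a(tau) + O(eps)) for a homogeneous polynomial a of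
    degree k ([flag_wave_leading]). In this basis D_N therefore becomes E B E, where E is
    diagonal with entries eps^level and B = G + O(eps); here G is the Gram matrix of the leading
    polynomials a over the cube, and replacing the mean over the grid by the integral costs
    O(1 / N), which is O(eps) as soon as 1 / N <= eps ([dirichlet_graded]). This is the only
    condition on N, and N_0 is chosen to ensure it.

    The matrix G does not depend on eps and is positive definite. Indeed the leading
    polynomials are linearly independent ([leading_coef_inj]), and the moment matrix of the
    cube is a tensor power of the Hankel matrix of the interval, whose positivity is that of
    the integral of a nonzero square ([hankel_real_gt0], [moment_gram_gt0]).

    A graded perturbation E B E of this kind has eigenvalues eps^(2 level) (l + O(eps)) with
    positive l independent of eps ([graded_perturbation]). The proof compares quadratic forms
    up to factors 1 + O(eps), which transfers to each eigenvalue however small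
    ([eigen_compare]), until a matrix is reached that commutes with E and whose eigenvalues are
    explicit ([graded_spectrum]).

    When eps stays away from 0, exact scaling reduces to the boundedness of the eigenvalues
    ([dirichlet_eigen_bounded]). Hence the constant C can be chosen before eps_0 and alpha. *)

Set Implicit Arguments.
Unset Strict Implicit.
Unset Printing Implicit Defensive.

Import Order.TTheory GRing.Theory Num.Theory.
Import numFieldNormedType.Exports.
Local Open Scope ring_scope.
Local Open Scope sesquilinear_scope.

(** * Hermitian matrices *)

(** Stated with an intertwining relation rather than a conjugation, so that it also covers
    the products (E M) adj(E M) and adj(E M) (E M), intertwined by E M. *)
Lemma char_poly_similar (F : fieldType) n (P A B : 'M[F]_n) :
  P \in unitmx -> P *m A = B *m P -> char_poly A = char_poly B.
Proof.
move=> Pu PA; rewrite /char_poly /char_poly_mx.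
pose Q := map_mx polyC P.
have dQ : \det Q != 0 by rewrite det_map_mx polyC_eq0 -unitfE -unitmxE.
apply: (mulfI dQ); rewrite -det_mulmx [in RHS]mulrC -det_mulmx; congr (\det _).
by rewrite mulmxBr mulmxBl scalar_mxC -!map_mxM PA.
Qed.

Lemma sum_lt_double (i j k : nat) : ~~ ((i == k) && (k == j)) ->
  (j <= k)%N -> (i <= k)%N -> (i + j < k + k)%N.
Proof. lia. Qed.

Section HermitianMatrices.
Variable C : numClosedFieldType.

Lemma adjM m n p (A : 'M[C]_(m, n)) (B : 'M_(n, p)) :
  (A *m B)^t* = B^t* *m A^t*.
Proof. by rewrite trmx_mul map_mxM. Qed.

Lemma dot_sum n (u v : 'rV[C]_n) :
  (u *m v^t*) 0 0 = \sum_i u 0 i * (v 0 i)^*.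
Proof. by rewrite mxE; apply: eq_bigr => i _; rewrite !mxE. Qed.

Lemma sqnorm_sum n (u : 'rV[C]_n) : (u *m u^t*) 0 0 = \sum_i `|u 0 i| ^+ 2.
Proof. by rewrite dot_sum; apply: eq_bigr => i _; rewrite normCK. Qed.

Lemma sqnorm_ge0 n (u : 'rV[C]_n) : 0 <= (u *m u^t*) 0 0.
Proof. by rewrite sqnorm_sum sumr_ge0 // => i _; rewrite exprn_ge0. Qed.

Lemma sqnorm_eq0 n (u : 'rV[C]_n) : ((u *m u^t*) 0 0 == 0) = (u == 0).
Proof.
apply/eqP/eqP => [|->]; last by rewrite mul0mx mxE.
rewrite sqnorm_sum => /psumr_eq0P h; apply/rowP => i; rewrite mxE.
have /eqP : `|u 0 i| ^+ 2 = 0 by apply: h => // j _; rewrite exprn_ge0.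
by rewrite expf_eq0 normr_eq0 /= => /eqP.
Qed.

Lemma exists_unit_orthogonal n p (U : 'M[C]_(p, n)) : (\rank U < n)%N ->
  exists v : 'rV[C]_n, (v *m v^t*) 0 0 = 1 /\ v *m U^t* = 0.
Proof.
move=> rU; pose v := nz_row (kermx (U^t*)).
have v0 : v != 0.
  rewrite nz_row_eq0 -mxrank_eq0 mxrank_ker -lt0n subn_gt0.
  by rewrite mxrank_map mxrank_tr.
have vU : v *m U^t* = 0 by apply/sub_kermxP/nz_row_sub.
pose c := (v *m v^t*) 0 0.
have c0 : c != 0 by rewrite sqnorm_eq0.
have sc : ((sqrtC c)^-1)^* = (sqrtC c)^-1.
  by apply/CrealP; rewrite realV ger0_real // sqrtC_ge0 sqnorm_ge0.
exists ((sqrtC c)^-1 *: v); split; last by rewrite -scalemxAl vU scaler0.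
rewrite -scalemxAl mxE linearZ /= map_mxZ /= -scalemxAr mxE mulrA sc.
by rewrite -invfM -expr2 sqrtCK mulVf.
Qed.

Lemma rank_zero_rows n p r (F : 'M[C]_(n, p)) : (r <= n)%N ->
  (forall i : 'I_n, (i < r)%N -> row i F = 0) -> (\rank F <= n - r)%N.
Proof.
move=> rn F0; suff -> : F = copid_mx r *m F.
  by apply: leq_trans (mxrankM_maxl _ _) _; rewrite rank_copid_mx.
rewrite mulmxBl mul1mx; apply/matrixP => i j; rewrite !mxE.
rewrite (bigD1 i) //= big1 => [|k ki]; last first.
  have nki : (i == k :> nat) = false by rewrite eq_sym; exact: negbTE.
  by rewrite mxE nki mul0r.
rewrite mxE eqxx /= addr0; case: (ltnP i r) => h; last by rewrite mul0r subr0.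
by move: (F0 i h) => /rowP/(_ j); rewrite !mxE => ->; rewrite mulr0 subr0.
Qed.

(** The source of both triangular structures of the proof: applied to the column spaces of
    the Vandermonde matrices it gives an orthonormal basis adapted to their flag, and applied
    to the rows of a square root of a positive definite matrix it gives a Cholesky factor. *)
Lemma greedy_unitary n (U : 'I_n -> 'M[C]_n) : (forall p, (\rank (U p) <= p)%N) ->
  exists2 Q : 'M[C]_n, Q \is unitarymx & forall p, row p Q *m (U p)^t* = 0.
Proof.
move=> rU.
(* Rows are chosen from the last one upwards. Row p has to avoid the n - 1 - p
   rows already chosen and U p, together at most n - 1 dimensions. *)
suff H j : (j <= n)%N -> exists f : 'I_n -> 'rV[C]_n,
    [/\ forall p : 'I_n, (p < n - j)%N -> f p = 0,
        forall p q, (f p *m (f q)^t*) 0 0 = ((p == q) && (n - j <= p)%N)%:R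
      & forall p, f p *m (U p)^t* = 0].
  have [f [_ f1 fU]] := H n (leqnn n); exists (\matrix_p f p).
    apply/row_unitarymxP => i j; rewrite !rowK dotmxE f1 subnn andbT.
    by [].
  by move=> p; rewrite rowK fU.
elim: j => [|j IH] jn.
  exists (fun=> 0); split=> // [p q|p]; last by rewrite mul0mx.
  by rewrite mul0mx mxE subn0 leqNgt ltn_ord andbF.
have [f [f0 f1 fU]] := IH (ltnW jn).
have pn : (n - j.+1 < n)%N by rewrite ltn_subrL /= (leq_ltn_trans _ jn).
pose p0 := Ordinal pn; pose F := \matrix_p f p.
have nj : (n - j = p0.+1)%N by rewrite /= -subSn // subSS.
have rF : (\rank F <= j)%N.
  apply: leq_trans (@rank_zero_rows _ _ (n - j) F _ _) _.
  - exact: leq_subr.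
  - by move=> i hi; rewrite rowK f0.
  - by rewrite subKn // ltnW.
have [v [v1 vU]] : exists v : 'rV[C]_n, (v *m v^t*) 0 0 = 1
   /\ v *m (col_mx F (U p0))^t* = 0.
  apply: exists_unit_orthogonal; rewrite -addsmxE.
  apply: leq_ltn_trans (mxrank_adds_leqif _ _) _.
  apply: leq_ltn_trans (leq_add rF (rU p0)) _.
  by rewrite /= -addSn subnKC.
rewrite tr_col_mx map_row_mx mul_mx_row in vU.
have vF : v *m F^t* = 0 by move: (congr1 lsubmx vU); rewrite row_mxKl linear0.
have {}vU : v *m (U p0)^t* = 0 by move: (congr1 rsubmx vU); rewrite row_mxKr linear0.
have vf q : (v *m (f q)^t*) 0 0 = 0.
  move: vF => /rowP/(_ q); rewrite mxE [RHS]mxE => <-; rewrite mxE.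
  by apply: eq_bigr => i _; rewrite !mxE.
have fv q : (f q *m v^t*) 0 0 = 0.
  have -> : f q *m v^t* = (v *m (f q)^t*)^t* by rewrite adjM trmxCK.
  by rewrite 2!mxE vf conjC0.
exists (fun q => if q == p0 then v else f q); split.
- move=> q hq; case: eqP => [e|_]; first by rewrite e ltnn in hq.
  by apply: f0; rewrite nj ltnW.
- move=> p q; have [/eqP->|pp] := boolP (p == p0); have [/eqP->|qp] := boolP (q == p0).
  + by rewrite eqxx v1 leqnn.
  + by rewrite vf eq_sym (negPf qp).
  + by rewrite fv (negPf pp).
  + rewrite f1 nj; case: eqP => //= _.
    rewrite [in RHS]leq_eqVlt [X in X || _](_ : _ = false) //.
    by rewrite eq_sym; apply: negbTE.
- by move=> q; case: eqP => [->|_].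
Qed.

(** The spectral theorem with decreasing eigenvalues, the order that makes the eigenvalues of
    two Hermitian matrices comparable index by index. *)
Lemma herm_sorted n (A : 'M[C]_n) : A^t* = A ->
  exists (V : 'M[C]_n) (a : 'I_n -> C),
   [/\ V \is unitarymx, (forall p, a p \is Num.real),
       forall p, row p V *m A = a p *: row p V,
       forall p q : 'I_n, (p <= q)%N -> a q <= a p
     & char_poly A = \prod_p ('X - (a p)%:P)].
Proof.
move=> Ah; have hA : A \is hermsymmx by apply/is_hermitianmxP; rewrite scale1r Ah.
have /orthomx_spectralP A_eq := hermitian_normalmx hA.
have dr := hermitian_spectral_diag_real hA.
set P := spectralmx A in A_eq; set d := spectral_diag A in A_eq dr.
have Pu : P \is unitarymx := spectral_unitarymx A.
have PA : P *m A = diag_mx d *m P.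
  by rewrite {1}A_eq !mulmxA mulmxV ?mul1mx // unitarymx_unit.
pose t := [tuple d 0 i | i < n].
have [s es] : exists s : {perm 'I_n}, sort >=%R t = [tuple tnth t (s i) | i < n].
  by apply/tuple_permP; rewrite perm_sort.
have dre i : d 0 i \is Num.real by apply: (mxOverP dr).
have ts i : tnth t i = d 0 i by rewrite tnth_mktuple.
exists (row_perm s P), (fun i => d 0 (s i)); split=> //.
- apply/row_unitarymxP => i j.
  have /row_unitarymxP h := Pu; move: (h (s i) (s j)).
  rewrite (inj_eq perm_inj) => <-.
  by congr (dotmx _ _); apply/rowP=> k; rewrite !mxE.
- move=> p; have -> : row p (row_perm s P) = row (s p) P by apply/rowP => k; rewrite !mxE.
  by rewrite -row_mul PA row_mul row_diag_mx -scalemxAl -rowE.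
- move=> p q pq.
  have e i : d 0 (s i) = nth 0 (sort >=%R t) i.
    by rewrite es -tnth_nth tnth_mktuple ts.
  rewrite !e.
  have tr : transitive (>=%R : rel C) by move=> x y z /= h1 h2; apply: le_trans h2 h1.
  have srt : sorted >=%R (sort >=%R t).
    apply: (@sort_sorted_in _ Num.real) => [x y xr yr|] /=.
      by rewrite orbC real_leVge.
    by apply/allP => x /mapP[i _ ->]; apply: dre.
  have sz : size (sort >=%R t) = n by rewrite size_sort size_tuple.
  apply: (sorted_leq_nth tr (fun x => lexx x) 0 srt) => //; by rewrite inE sz.
- rewrite (char_poly_similar (unitarymx_unit Pu) PA).
  rewrite char_poly_trig ?diag_mx_is_trig //.
  rewrite [RHS](reindex_inj (@perm_inj _ (s^-1)%g)) /=; apply: eq_bigr => i _.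
  by rewrite permKV mxE eqxx mulr1n.
Qed.


Definition qform n (A : 'M[C]_n) (x : 'rV[C]_n) : C := (x *m A *m x^t*) 0 0.

Lemma qform_eigen n (A V : 'M[C]_n) (a : 'I_n -> C) (c : 'rV[C]_n) :
  V \is unitarymx -> (forall p, row p V *m A = a p *: row p V) ->
  qform A (c *m V) = \sum_i a i * `|c 0 i| ^+ 2.
Proof.
move=> Vu Va; have VA : V *m A = diag_mx (\row_i a i) *m V.
  by apply/row_matrixP => p; rewrite !row_mul Va row_diag_mx -scalemxAl -rowE mxE.
rewrite /qform -[c *m V *m A]mulmxA VA adjM !mulmxA.
rewrite (mulmxtVK _ Vu) mxE; apply: eq_bigr => i _.
by rewrite mul_mx_diag !mxE mulrAC -normCK mulrC.
Qed.

Lemma sqnorm_unitary n (V : 'M[C]_n) (c : 'rV[C]_n) : V \is unitarymx ->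
  (c *m V *m (c *m V)^t*) 0 0 = \sum_i `|c 0 i| ^+ 2.
Proof. by move=> Vu; rewrite adjM mulmxA (mulmxtVK _ Vu) sqnorm_sum. Qed.

(** Weyl's monotonicity principle: on a common vector of a top eigenspace of A and a bottom
    eigenspace of B the two quadratic forms bound the two eigenvalues of index p. The
    factors s and s' allow a multiplicative comparison from either side. *)
Lemma eigen_mono n (A B V W : 'M[C]_n) (a b : 'I_n -> C) (s s' : C) :
  0 <= s -> 0 <= s' -> V \is unitarymx -> W \is unitarymx ->
  (forall p, row p V *m A = a p *: row p V) ->
  (forall p, row p W *m B = b p *: row p W) ->
  (forall p q : 'I_n, (p <= q)%N -> a q <= a p) ->
  (forall p q : 'I_n, (p <= q)%N -> b q <= b p) ->
  (forall x, s * qform A x <= s' * qform B x) ->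
  forall p, s * a p <= s' * b p.
Proof.
move=> s0 s0' Vu Wu Va Wb sa sb AB p.
(* The eigenvectors of A of index <= p span p + 1 dimensions and those of B of
   index >= p span n - p, so the two spans share a nonzero vector x. *)
pose X := pid_mx p.+1 *m V : 'M[C]_n; pose Y := copid_mx p *m W : 'M[C]_n.
have rX : \rank X = p.+1.
  rewrite mxrankMfree ?row_free_unit ?unitarymx_unit //.
  by rewrite rank_pid_mx.
have rY : \rank Y = (n - p)%N.
  rewrite mxrankMfree ?row_free_unit ?unitarymx_unit // rank_copid_mx //.
  exact: ltnW.
pose x := nz_row (X :&: Y)%MS.
have x0 : x != 0.
  rewrite nz_row_eq0 -mxrank_eq0 -lt0n -(ltn_add2l (\rank (X + Y)%MS)).
  rewrite mxrank_sum_cap rX rY addn0 addSn subnKC ?ltnS ?rank_leq_col //.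
  exact: ltnW.
have /submxP[y xy] : (x <= X)%MS by apply: submx_trans (nz_row_sub _) (capmxSl _ _).
have /submxP[z xz] : (x <= Y)%MS by apply: submx_trans (nz_row_sub _) (capmxSr _ _).
rewrite mulmxA in xy; rewrite mulmxA in xz.
set c := y *m _ in xy; set e := z *m _ in xz.
have c0 (i : 'I_n) : (p < i)%N -> c 0 i = 0.
  move=> pi; rewrite mxE big1 // => j _; rewrite mxE.
  by case: eqP => [->|]; rewrite ?mulr0 //= ltnS leqNgt pi mulr0.
have e0 (i : 'I_n) : (i < p)%N -> e 0 i = 0.
  move=> ip; rewrite mxE big1 // => j _; rewrite !mxE -val_eqE.
  by case: eqP => [->|]; rewrite ?subrr ?mulr0 //= ip subrr mulr0.
have nx : \sum_i `|c 0 i| ^+ 2 = \sum_i `|e 0 i| ^+ 2.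
  by rewrite -(sqnorm_unitary c Vu) -(sqnorm_unitary e Wu) -xy -xz.
have nx0 : 0 < \sum_i `|c 0 i| ^+ 2.
  rewrite -(sqnorm_unitary c Vu) -xy lt_def sqnorm_ge0 andbT.
  by rewrite sqnorm_eq0.
rewrite -(ler_pM2r nx0) -!mulrA.
apply: (@le_trans _ _ (s * qform A x)).
  apply: ler_wpM2l => //; rewrite xy (qform_eigen c Vu Va) mulr_sumr ler_sum // => i _.
  case: (leqP i p) => h; first by rewrite ler_wpM2r ?exprn_ge0 ?sa.
  by rewrite c0 // normr0 expr0n !mulr0.
apply: le_trans (AB x) _; apply: ler_wpM2l => //.
rewrite nx xz (qform_eigen e Wu Wb) mulr_sumr ler_sum // => i _.
case: (leqP p i) => h; first by rewrite ler_wpM2r ?exprn_ge0 ?sb.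
by rewrite e0 // normr0 expr0n !mulr0.
Qed.

(** A two-sided multiplicative comparison of Hermitian forms is inherited by the eigenvalues.
    One matching of the eigenvalues, the one given by sorting, serves for both bounds, and the
    eigenvalues d of the reference matrix may come in any order. Relative bounds are essential:
    the eigenvalues at stake have very different orders of magnitude. *)
Lemma eigen_compare n (A A' : 'M[C]_n) (d : 'I_n -> C) (s1 s2 : C) :
  A^t* = A -> A'^t* = A' -> 0 <= s1 -> 0 <= s2 ->
  char_poly A' = \prod_p ('X - (d p)%:P) ->
  (forall x, s1 * qform A' x <= qform A x <= s2 * qform A' x) ->
  exists2 lam : 'I_n -> C, char_poly A = \prod_p ('X - (lam p)%:P) &
    forall p, s1 * d p <= lam p <= s2 * d p.
Proof.
move=> Ah Ah' s10 s20 cd AA'.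
have [V [a [Vu ar Va sa ca]]] := herm_sorted Ah.
have [W [b [Wu br Wb sb cb]]] := herm_sorted Ah'.
have [s es] : exists s : {perm 'I_n}, forall p, d p = b (s p).
  have : perm_eq [tuple d p | p < n] [tuple b p | p < n].
    apply: prod_XsubC_eq; rewrite !big_tuple.
    under eq_bigr do rewrite tnth_mktuple.
    by under [RHS]eq_bigr do rewrite tnth_mktuple; rewrite -cd.
  move=> /tuple_permP[s /val_inj e]; exists s => p.
  by have := congr1 (fun t => tnth t p) e; rewrite /= !tnth_mktuple.
exists (a \o s) => [|p]; first by rewrite ca (reindex_inj (@perm_inj _ s)).
rewrite /= es; apply/andP; split.
  rewrite -[leRHS]mul1r.
  apply: (eigen_mono (B := A) (A := A') _ _ Wu Vu) => // x.
  by rewrite mul1r; case/andP: (AA' x).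
rewrite -[leLHS]mul1r.
apply: (eigen_mono (B := A') (A := A) _ _ Vu Wu) => // x.
by rewrite mul1r; case/andP: (AA' x).
Qed.


Lemma unitary_row_neq0 n (V : 'M[C]_n) p : V \is unitarymx -> row p V != 0.
Proof.
move=> Vu; rewrite -sqnorm_eq0 -dotmxE (row_unitarymxP Vu) eqxx.
exact: oner_neq0.
Qed.

Lemma unitarymxVP n (V : 'M[C]_n) : V \is unitarymx -> V^t* *m V = 1%:M.
Proof. by rewrite -trmxC_unitary => /unitarymxP; rewrite trmxCK. Qed.

(** The Cholesky factorization, obtained as a unitary rotation of a square root of A. *)
Lemma pd_lower_factor n (A : 'M[C]_n) : A^t* = A ->
  (forall x, x != 0 -> 0 < qform A x) ->
  exists M : 'M[C]_n, [/\ M \in unitmx, A = M *m M^t* &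
    forall p q : 'I_n, (p < q)%N -> M p q = 0].
Proof.
move=> Ah Apos; have [V [a [Vu _ Va _ _]]] := herm_sorted Ah.
have a0 p : 0 < a p.
  have := Apos _ (unitary_row_neq0 p Vu).
  by rewrite /qform Va -scalemxAl mxE -dotmxE (row_unitarymxP Vu) eqxx mulr1.
pose D := diag_mx (\row_i sqrtC (a i)).
have Dh : D^t* = D.
  rewrite tr_diag_mx map_diag_mx; congr diag_mx; apply/rowP => i; rewrite !mxE.
  by apply/CrealP; rewrite ger0_real // sqrtC_ge0 ltW.
have DD : D *m D = diag_mx (\row_i a i).
  rewrite mulmx_diag; congr diag_mx; apply/rowP => i; rewrite !mxE.
  by rewrite -expr2 sqrtCK.
have VA : V *m A = D *m D *m V.
  apply/row_matrixP => p; rewrite DD row_mul Va row_mul.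
  by rewrite row_diag_mx -scalemxAl -rowE mxE.
pose X := V^t* *m D.
have VV := unitarymxVP Vu.
have AX : A = X *m X^t*.
  by rewrite adjM Dh trmxCK /X !mulmxA -[_ *m D *m D]mulmxA -[_ *m V]mulmxA -VA
     mulmxA VV mul1mx.
have Du : D \in unitmx.
  rewrite unitmxE det_diag unitfE; apply/prodf_neq0 => i _.
  by rewrite mxE sqrtC_eq0 gt_eqF.
(* X is a square root of A. Row q of the unitary O is orthogonal to the rows of
   X of index < q, which makes X times the adjoint of O lower triangular. *)
have [O Ou OU] : exists2 O : 'M[C]_n, O \is unitarymx &
    forall p : 'I_n, row p O *m (pid_mx p *m X : 'M[C]_n)^t* = 0.
  apply: greedy_unitary => p; apply: leq_trans (mxrankM_maxl _ _) _.
  by rewrite rank_pid_mx // ltnW.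
exists (X *m O^t*); split.
- by rewrite !unitmx_mul Du !unitarymx_unit // trmxC_unitary.
- rewrite adjM trmxCK mulmxA.
  by rewrite -[X *m _ *m O]mulmxA unitarymxVP // mulmx1.
- move=> p q pq; have -> : X *m O^t* = (O *m X^t*)^t* by rewrite adjM trmxCK.
  rewrite 2!mxE; apply/eqP; rewrite conjC_eq0; apply/eqP.
  move: (OU q) => /rowP/(_ p); rewrite [RHS]mxE => <-.
  have pE i j : ((pid_mx q : 'M[C]_n)^t*) i j = ((j == i :> nat) && (j < q)%N)%:R.
    by rewrite !mxE conjC_nat.
  rewrite (adjM (pid_mx q) X) -row_mul mulmxA [RHS]mxE [RHS]mxE (bigD1 p) //=.
  rewrite big1 ?addr0 => [|k kp].
    by rewrite pE eqxx pq mulr1.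
  rewrite pE [_ == _](_ : _ = false) ?mulr0 //.
  by rewrite eq_sym; apply: negbTE.
Qed.

(** An entrywise perturbation of size delta changes a positive definite form by a relative
    error of size delta, because the vector x M controls x when M is invertible. *)
Lemma perturb_form_le n (M : 'M[C]_n) : M \in unitmx ->
  exists2 K : C, 0 <= K & forall (B : 'M[C]_n) (delta : C),
    (forall p q, `|B p q| <= delta) ->
    forall x, `|qform B x| <= K * delta * qform (M *m M^t*) x.
Proof.
move=> Mu; pose k : C := \sum_p \sum_q `|invmx M p q|.
have k0 : 0 <= k by rewrite !sumr_ge0 // => p _; rewrite sumr_ge0.
exists (k ^+ 2 *+ (n * n)) => [|B delta Bd x]; first by rewrite mulrn_wge0 ?exprn_ge0.
pose z := x *m M.
have -> : qform (M *m M^t*) x = (z *m z^t*) 0 0 by rewrite /qform adjM !mulmxA.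
set S := (z *m _) 0 0; pose s := sqrtC S.
have S0 : 0 <= S := sqnorm_ge0 z.
have s0 : 0 <= s by rewrite sqrtC_ge0.
have zs q : `|z 0 q| <= s.
  rewrite -(ler_pXn2r (_ : 0 < 2)%N) ?nnegrE // sqrtCK /S sqnorm_sum (bigD1 q) //=.
  by rewrite lerDl sumr_ge0 // => i _; rewrite exprn_ge0.
have xk p : `|x 0 p| <= k * s.
  have -> : x = z *m invmx M by rewrite mulmxK.
  rewrite mxE; apply: le_trans (ler_norm_sum _ _ _) _.
  rewrite mulr_suml ler_sum // => q _; rewrite normrM mulrC.
  apply: ler_pM => //; rewrite (bigD1 p) //= lerDl.
  by rewrite sumr_ge0.
have ks0 : 0 <= k * s by rewrite mulr_ge0.
rewrite /qform mxE; apply: le_trans (ler_norm_sum _ _ _) _.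
have -> : k ^+ 2 *+ (n * n) * delta * S = \sum_(i < n) \sum_(j < n) (k * s) * delta * (k * s).
  rewrite !sumr_const card_ord -mulrnA.
  rewrite (_ : k * s * delta * (k * s) = k ^+ 2 * delta * S).
    by rewrite -!mulrnAl.
  by rewrite -[S]sqrtCK -/s expr2 expr2 mulrACA [X in X * _]mulrAC -!mulrA [delta * _]mulrCA.
rewrite ler_sum // => j _; rewrite normrM mxE.
rewrite !mxE norm_conjC; apply: le_trans (ler_wpM2r _ (ler_norm_sum _ _ _)) _ => //.
rewrite mulr_suml ler_sum // => i _; rewrite normrM.
by apply: ler_pM => //; rewrite ?mulr_ge0 //; apply: ler_pM.
Qed.


Lemma qform_real n (A : 'M[C]_n) x : A^t* = A -> qform A x \is Num.real.
Proof.
move=> Ah; apply/CrealP; rewrite /qform.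
have e : x *m A *m x^t* = (x *m A *m x^t*)^t* by rewrite !adjM trmxCK Ah mulmxA.
by rewrite [in RHS]e !mxE.
Qed.

Lemma qformB n (A B : 'M[C]_n) x : qform (A - B) x = qform A x - qform B x.
Proof. by rewrite /qform mulmxBr mulmxBl !mxE. Qed.

Lemma qform_conj n (A E : 'M[C]_n) x :
  qform (E *m A *m E^t*) x = qform A (x *m E).
Proof. by rewrite /qform adjM !mulmxA. Qed.

Lemma qform_MMt_gt0 n (M : 'M[C]_n) x : M \in unitmx -> x != 0 ->
  0 < qform (M *m M^t*) x.
Proof.
move=> Mu x0; rewrite /qform mulmxA -[_ *m x^t*]mulmxA -adjM lt_def sqnorm_ge0 andbT.
rewrite sqnorm_eq0; apply: contra x0 => /eqP e.
by rewrite -(mulmxK Mu x) e mul0mx.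
Qed.

(** A Hermitian matrix that is block diagonal for the levels w commutes with the scaling
    by eps ^+ w, so scaling multiplies the eigenvalues of each block by eps ^+ (2 w) exactly.
    The eigenvalues l do not depend on eps. *)
Lemma graded_spectrum n (L : 'M[C]_n) (w : 'I_n -> nat) : L^t* = L ->
  (forall x, x != 0 -> 0 < qform L x) ->
  (forall p q, w p != w q -> L p q = 0) ->
  exists2 l : 'I_n -> C, (forall p, 0 < l p) &
    forall eps : C, let E := diag_mx (\row_p eps ^+ w p) in
      char_poly (E *m L *m E) = \prod_p ('X - (eps ^+ (2 * w p) * l p)%:P).
Proof.
move=> Lh Lpos Lw; pose W : 'M[C]_n := diag_mx (\row_p (w p)%:R).
have Wh : W^t* = W.
  rewrite tr_diag_mx map_diag_mx; congr diag_mx; apply/rowP => i; rewrite !mxE.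
  exact: conjC_nat.
have WL : W *m L = L *m W.
  apply/matrixP => p q; rewrite mul_diag_mx mul_mx_diag !mxE mulrC.
  by have [->|/Lw->] := eqVneq (w p) (w q); rewrite ?mul0r.
(* W and L are commuting Hermitian matrices, so W + i L is normal and a unitary
   diagonalizing it diagonalizes both: rho and l are the real and imaginary
   parts of its eigenvalues. *)
pose Z := W + 'i *: L.
have Zh : Z^t* = W - 'i *: L.
  rewrite /Z linearD /= map_mxD Wh linearZ /= map_mxZ /= Lh conjCi.
  by rewrite scaleNr.
have /orthomx_spectralP Z_eq : Z \is normalmx.
  apply/normalmxP; rewrite Zh /Z mulmxBr mulmxDl mulmxBl !mulmxDr.
  by rewrite -!scalemxAl -!scalemxAr WL mulmxDl -scalemxAl WL scalerDr.
set P := spectralmx Z in Z_eq; set d := spectral_diag Z in Z_eq.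
have Pu : P \is unitarymx := spectral_unitarymx Z.
have PZ : P *m Z = diag_mx d *m P.
  by rewrite {1}Z_eq !mulmxA mulmxV ?mul1mx // unitarymx_unit.
have PZh : P *m Z^t* = diag_mx (map_mx Num.conj d) *m P.
  have {1}-> : Z = P^t* *m diag_mx d *m P by rewrite {1}Z_eq invmx_unitary.
  rewrite !adjM trmxCK tr_diag_mx map_diag_mx !mulmxA.
  by rewrite (unitarymxP Pu) mul1mx.
rewrite Zh in PZh; rewrite /Z in PZ.
pose rho p := (d 0 p + (d 0 p)^*) / 2.
pose l p := (d 0 p - (d 0 p)^*) / (2 * 'i).
have two0 : (2 : C) != 0 by rewrite pnatr_eq0.
have PW p q : P p q * (w q)%:R = rho p * P p q.
  move: PZ PZh => /matrixP/(_ p q) + /matrixP/(_ p q).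
  rewrite mulmxDr mulmxBr -!scalemxAr !mul_diag_mx mul_mx_diag !mxE => e1 e2.
  apply: (mulfI two0); rewrite [RHS]mulrA /rho [2 * (_ / 2)]mulrC divfK //.
  rewrite [RHS]mulrDl -e1 -e2; ring.
have PL p q : (P *m L) p q = l p * P p q.
  move: PZ PZh => /matrixP/(_ p q) + /matrixP/(_ p q).
  rewrite mulmxDr mulmxBr -!scalemxAr !mul_diag_mx mul_mx_diag !mxE => e1 e2.
  have i0 : 2 * 'i != 0 :> C by rewrite mulf_neq0 // neq0Ci.
  apply: (mulfI i0); rewrite [RHS]mulrA /l [2 * 'i * (_ / _)]mulrC divfK //.
  rewrite [RHS]mulrBl -e1 -e2; ring.
(* Both families are the eigenvalues of W. *)
have [s es] : exists s : {perm 'I_n}, forall p, rho p = (w (s p))%:R.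
  have : perm_eq [tuple rho p | p < n] [tuple (w p)%:R : C | p < n].
    apply: prod_XsubC_eq; rewrite !big_tuple.
    under eq_bigr do rewrite tnth_mktuple.
    under [RHS]eq_bigr do rewrite tnth_mktuple.
    transitivity (char_poly (diag_mx (\row_p rho p))).
      rewrite char_poly_trig ?diag_mx_is_trig //; apply: eq_bigr => p _.
      by rewrite !mxE eqxx mulr1n.
    transitivity (char_poly W).
      apply/esym/(char_poly_similar (unitarymx_unit Pu))/matrixP => p q.
      by rewrite mul_mx_diag mul_diag_mx !mxE PW.
    rewrite char_poly_trig ?diag_mx_is_trig //; apply: eq_bigr => p _.
    by rewrite !mxE eqxx mulr1n.
  move=> /tuple_permP[s /val_inj e]; exists s => p.
  by have := congr1 (fun t => tnth t p) e; rewrite /= !tnth_mktuple.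
exists (fun p => l ((s^-1)%g p)) => [p|eps E].
  have := Lpos _ (unitary_row_neq0 ((s^-1)%g p) Pu).
  rewrite /qform -row_mul.
  have -> : row ((s^-1)%g p) (P *m L) = l ((s^-1)%g p) *: row ((s^-1)%g p) P.
    by apply/rowP => q; rewrite mxE PL !mxE.
  by rewrite -scalemxAl mxE -dotmxE (row_unitarymxP Pu) eqxx mulr1.
pose E' := diag_mx (\row_p eps ^+ w (s p)).
have PE : P *m E = E' *m P.
  apply/matrixP => p q; rewrite mul_mx_diag mul_diag_mx !mxE mulrC.
  have [->|P0] := eqVneq (P p q) 0; first by rewrite !mulr0.
  have := PW p q; rewrite [LHS]mulrC es => h; have /eqP := mulIf P0 h.
  by rewrite eqr_nat => /eqP->.
have PLm : P *m L = diag_mx (\row_p l p) *m P.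
  by apply/matrixP => p q; rewrite PL mul_diag_mx !mxE.
have PELE : P *m (E *m L *m E) = E' *m diag_mx (\row_p l p) *m E' *m P.
  by rewrite !mulmxA PE -[E' *m P *m L]mulmxA PLm !mulmxA -[_ *m P *m E]mulmxA PE !mulmxA.
rewrite (char_poly_similar (unitarymx_unit Pu) PELE) !mulmx_diag.
rewrite char_poly_trig ?diag_mx_is_trig // [RHS](reindex_inj (@perm_inj _ s)) /=.
apply: eq_bigr => p _; rewrite !mxE eqxx mulr1n permK.
by rewrite mul2n -addnn exprD mulrAC.
Qed.

Lemma qform_between n (A A' : 'M[C]_n) (e : C) : A^t* = A -> A'^t* = A' ->
  (forall x, `|qform (A - A') x| <= e * qform A' x) ->
  forall x, (1 - e) * qform A' x <= qform A x <= (1 + e) * qform A' x.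
Proof.
move=> Ah Ah' h x; have := h x; rewrite real_ler_norml; last first.
  by rewrite qformB realB ?qform_real.
rewrite qformB => /andP[h1 h2]; rewrite mulrBl mulrDl mul1r.
by rewrite -lerBlDl h2 andbT addrC -lerBrDr.
Qed.


(** * Perturbation of graded matrices *)

Definition grading n (w : 'I_n -> nat) (eps : C) : 'M[C]_n :=
  diag_mx (\row_p eps ^+ w p).

Lemma grading_adj n (w : 'I_n -> nat) eps : eps \is Num.real ->
  (grading w eps)^t* = grading w eps.
Proof.
move=> er; rewrite tr_diag_mx map_diag_mx; congr diag_mx; apply/rowP => i.
by rewrite !mxE; apply/CrealP/realX.
Qed.

Lemma gradingE n (w : 'I_n -> nat) eps (A : 'M[C]_n) p q :
  (grading w eps *m A *m grading w eps) p q = eps ^+ w p * A p q * eps ^+ w q.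
Proof. by rewrite mul_mx_diag mxE mul_diag_mx !mxE. Qed.

Lemma grading_unit n (w : 'I_n -> nat) eps : eps != 0 -> grading w eps \in unitmx.
Proof.
move=> e0; rewrite unitmxE det_diag unitfE; apply/prodf_neq0 => i _.
by rewrite mxE expf_neq0.
Qed.

Lemma herm_conj n (A E : 'M[C]_n) : A^t* = A -> E^t* = E ->
  (E *m A *m E)^t* = E *m A *m E.
Proof. by move=> Ah Eh; rewrite !adjM Ah Eh mulmxA. Qed.

Lemma lower_trig_unit n (M : 'M[C]_n) : (forall p q : 'I_n, (p < q)%N -> M p q = 0) ->
  (M \in unitmx) = [forall p, M p p != 0].
Proof.
move=> Mt; rewrite unitmxE unitfE det_trig; last exact/is_trig_mxP.
by apply/prodf_neq0/forallP => h p //; exact: h.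
Qed.

(** Stated with a quotient because the exponents meet as 2 w r and w p + w q. *)
Lemma exp_ratio_le (a b : nat) (eps : C) : 0 < eps -> eps <= 1 -> (b < a)%N ->
  `|eps ^+ a / eps ^+ b| <= eps.
Proof.
move=> e0 e1 ba; have e00 := ltW e0.
rewrite -expfB // ger0_norm; last exact: exprn_ge0.
by rewrite -[leRHS]expr1; apply: ler_wiXn2l => //; rewrite subn_gt0.
Qed.

(** The perturbation theorem behind the exact scaling: if B = G + O(eps) with G positive
    definite and E is the grading, then E B E has eigenvalues eps ^+ (2 w) (l + O(eps)).
    Write G = M adj(M) with M lower triangular. Up to a relative error O(eps), E B E may be
    replaced by E G E = (E M) adj(E M), which has the eigenvalues of adj(M) E E M. Since the
    levels increase, this matrix is E (L + O(eps)) E, where L comes from the diagonal blocks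
    of M; a second relative comparison leads to E L E, whose eigenvalues are explicit. *)
Lemma graded_perturbation n (G : 'M[C]_n) (w : 'I_n -> nat) :
  G^t* = G -> (forall x, x != 0 -> 0 < qform G x) ->
  (forall p q : 'I_n, (p <= q)%N -> (w p <= w q)%N) ->
  exists2 l : 'I_n -> C, (forall p, 0 < l p) &
  forall K0 : C, 0 <= K0 -> exists K e1 : C, [/\ 0 < K, 0 < e1 &
    forall (eps : C) (B : 'M[C]_n), 0 < eps <= e1 -> B^t* = B ->
      (forall p q, `|B p q - G p q| <= K0 * eps) ->
      exists2 lam : 'I_n -> C,
        char_poly (grading w eps *m B *m grading w eps) = \prod_p ('X - (lam p)%:P)
      & forall p, lam p \is Num.real /\
          `|lam p - eps ^+ (2 * w p) * l p| <= K * eps * eps ^+ (2 * w p)].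
Proof.
move=> Gh Gpos wm.
have [M [Mu GM Mt]] := pd_lower_factor Gh Gpos.
(* The adjoint of N is the block diagonal part of M. *)
pose N : 'M[C]_n := (\matrix_(p, q) (if w p == w q then M p q else 0))^t*.
have Nu : N \in unitmx.
  rewrite map_unitmx unitmx_tr lower_trig_unit => [|p q pq].
    move: Mu; rewrite lower_trig_unit // => /forallP h; apply/forallP => p.
    by rewrite mxE eqxx.
  by rewrite mxE Mt // if_same.
pose L := N *m N^t*.
have Lh : L^t* = L by rewrite adjM trmxCK.
have LE p q : L p q = \sum_r ((w p == w r) && (w r == w q))%:R * ((M r p)^* * M r q).
  rewrite /L trmxCK mxE; apply: eq_bigr => r _; rewrite !mxE [w r == w p]eq_sym.
  by case: eqP; case: eqP => _ _; rewrite ?conjC0 ?(mul0r, mulr0, mul1r).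
have Lpos x : x != 0 -> 0 < qform L x by exact: qform_MMt_gt0.
have Lw p q : w p != w q -> L p q = 0.
  move=> pq; rewrite LE big1 // => r _.
  by case: eqP => [<-|]; rewrite ?(negPf pq) /= mul0r.
have [l l0 lE] := graded_spectrum Lh Lpos Lw.
exists l => // K0 K00.
have [K1 K10 H1] := perturb_form_le Mu.
have [K2 K20 H2] := perturb_form_le Nu.
pose K3 := \sum_p \sum_q \sum_r `|M r p| * `|M r q|.
have K3pq p q : \sum_r `|M r p| * `|M r q| <= K3.
  have pos i j : 0 <= \sum_r `|M r i| * `|M r j|.
    by rewrite sumr_ge0 // => r _; rewrite mulr_ge0.
  apply: (@le_trans _ _ (\sum_q \sum_r `|M r p| * `|M r q|)).
    by rewrite [leRHS](bigD1 q) //= lerDl sumr_ge0.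
  by rewrite [leRHS](bigD1 p) //= lerDl sumr_ge0 // => i _; rewrite sumr_ge0.
have K30 : 0 <= K3.
  by rewrite !sumr_ge0 // => p _; rewrite sumr_ge0 // => q _;
     rewrite sumr_ge0 // => r _; rewrite mulr_ge0.
pose a := K1 * K0; pose b := K2 * K3.
have a0 : 0 <= a by rewrite mulr_ge0.
have b0 : 0 <= b by rewrite mulr_ge0.
have sl0 : 0 <= \sum_p l p by rewrite sumr_ge0 // => p _; rewrite ltW.
(* The two comparisons lose the factors 1 +- a eps and 1 +- b eps; the bound e1
   on eps keeps both nonnegative. *)
exists ((a + b + a * b) * (\sum_p l p) + 1), (1 + a + b)^-1; split.
- by rewrite ltr_wpDl // mulr_ge0 // !addr_ge0 // mulr_ge0.
- by rewrite invr_gt0 -addrA ltr_wpDr // addr_ge0.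
move=> eps B /andP[e0 ee1] Bh BG.
have D0 : 0 < 1 + a + b by rewrite -addrA ltr_wpDr // addr_ge0.
have eD : eps * (1 + a + b) <= 1 by rewrite -ler_pdivlMr // mul1r.
have e00 := ltW e0.
have ea0 : 0 <= a * eps by rewrite mulr_ge0.
have eb0 : 0 <= b * eps by rewrite mulr_ge0.
have eD' : eps + a * eps + b * eps <= 1 by move: eD; rewrite !mulrDr mulr1 ![eps * _]mulrC.
have e1 : eps <= 1 by apply: le_trans eD'; rewrite -addrA lerDl addr_ge0.
have ea1 : a * eps <= 1 by apply: le_trans eD'; rewrite addrAC lerDr addr_ge0.
have eb1 : b * eps <= 1 by apply: le_trans eD'; rewrite lerDr addr_ge0.
set E := grading w eps.
have Eh : E^t* = E by rewrite grading_adj ?ger0_real.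
have Eu : E \in unitmx by rewrite grading_unit ?gt_eqF.
(* E G E = (E M) adj(E M) and S = adj(E M) (E M) have the same eigenvalues; since M
   is lower triangular, S = E (L + O(eps)) E. *)
pose S := M^t* *m (E *m E) *m M.
have Sh : S^t* = S by rewrite /S !adjM trmxCK Eh !mulmxA.
pose R := \matrix_(p, q) (S p q / eps ^+ (w p + w q) - L p q).
have SR : S - E *m L *m E = E *m R *m E^t*.
  rewrite Eh; apply/matrixP => p q.
  have en k : eps ^+ k != 0 by rewrite expf_neq0 // gt_eqF.
  rewrite [LHS]mxE [X in _ + X]mxE !gradingE [R p q]mxE exprD.
  by field; rewrite !en.
have RK p q : `|R p q| <= K3 * eps.
  have -> : R p q = \sum_r ((M r p)^* * M r q) *
      (eps ^+ (2 * w r) / eps ^+ (w p + w q) - ((w p == w r) && (w r == w q))%:R).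
    rewrite mxE LE /S mulmx_diag mxE mulr_suml -sumrB; apply: eq_bigr => r _.
    rewrite mul_mx_diag !mxE mul2n -addnn !exprD.
    move: (_%:R : C) ((M r p)^*) (M r q) (eps ^+ w r) (_^-1 : C) => z1 z2 z3 z4 z5; ring.
  apply: le_trans (ler_norm_sum _ _ _) _.
  apply: le_trans (ler_wpM2r e00 (K3pq p q)).
  rewrite mulr_suml ler_sum // => r _; rewrite normrM normrM norm_conjC.
  case: (ltnP r p) => rp; first by rewrite Mt // normr0 !mul0r.
  case: (ltnP r q) => rq; first by rewrite (Mt r q) // normr0 mulr0 !mul0r.
  apply: ler_wpM2l; first by rewrite mulr_ge0.
  (* As r >= p and r >= q, the exponent 2 w r - w p - w q is nonnegative and
     vanishes only if the three weights agree. *)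
  have [|ne] := boolP ((w p == w r) && (w r == w q)).
    case/andP=> /eqP-> /eqP<-; rewrite mul2n -addnn divff ?subrr ?normr0 //.
    by rewrite expf_neq0 // gt_eqF.
  rewrite subr0 exp_ratio_le // mul2n -addnn.
  exact: sum_lt_double ne (wm _ _ rq) (wm _ _ rp).
have qE A x : qform (E *m A *m E) x = qform A (x *m E).
  by have := qform_conj A E x; rewrite Eh.
have Sform : forall x, (1 - b * eps) * qform (E *m L *m E) x <= qform S x
   <= (1 + b * eps) * qform (E *m L *m E) x.
  apply: qform_between => // [|x]; first exact: herm_conj.
  by rewrite SR Eh !qE /b -(mulrA K2) H2.
have Bform : forall x, (1 - a * eps) * qform (E *m G *m E) x <= qform (E *m B *m E) x
   <= (1 + a * eps) * qform (E *m G *m E) x.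
  apply: qform_between => [||x]; try exact: herm_conj.
  rewrite -mulmxBl -mulmxBr !qE /a -(mulrA K1) GM H1 // => p q.
  by rewrite -GM !mxE.
have [mu cmu mub] : exists2 mu : 'I_n -> C,
    char_poly S = \prod_p ('X - (mu p)%:P) &
    forall p, (1 - b * eps) * (eps ^+ (2 * w p) * l p) <= mu p
      <= (1 + b * eps) * (eps ^+ (2 * w p) * l p).
  apply: eigen_compare Sform => //; rewrite ?subr_ge0 ?addr_ge0 //.
  exact: herm_conj.
  exact: lE.
have [lam clam lamb] : exists2 lam : 'I_n -> C,
    char_poly (E *m B *m E) = \prod_p ('X - (lam p)%:P) &
    forall p, (1 - a * eps) * mu p <= lam p <= (1 + a * eps) * mu p.
  apply: eigen_compare Bform; rewrite ?subr_ge0 ?addr_ge0 ?herm_conj //.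
  rewrite -cmu; apply/esym.
  apply: (@char_poly_similar _ _ (E *m M)); first by rewrite unitmx_mul Eu.
  by rewrite GM !mulmxA.
exists lam => // p.
have [/andP[m1 m2] /andP[n1 n2]] := (mub p, lamb p).
set d := eps ^+ (2 * w p) in m1 m2 *.
have d0 : 0 <= d by rewrite exprn_ge0.
have dl0 : 0 <= d * l p by rewrite mulr_ge0 // ltW.
pose c := a + b + a * b; have c0 : 0 <= c by rewrite !addr_ge0 // mulr_ge0.
have u : lam p <= (1 + c * eps) * (d * l p).
  apply: le_trans n2 _; apply: le_trans (ler_wpM2l _ m2) _; first by rewrite addr_ge0.
  rewrite [leLHS]mulrA; apply: ler_wpM2r => //.
  rewrite -subr_ge0 (_ : _ - _ = a * b * eps * (1 - eps)); last by rewrite /c; ring.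
  by rewrite !mulr_ge0 // subr_ge0.
have v : (1 - c * eps) * (d * l p) <= lam p.
  apply: le_trans n1; apply: le_trans (ler_wpM2l _ m1); last by rewrite subr_ge0.
  rewrite [leRHS]mulrA; apply: ler_wpM2r => //.
  rewrite -subr_ge0 (_ : _ - _ = a * b * eps + a * b * eps * eps); last by rewrite /c; ring.
  by rewrite addr_ge0 // !mulr_ge0.
have dr : d * l p \is Num.real by rewrite ger0_real.
have lr : lam p \is Num.real.
  by rewrite (ler_real u) ger0_real // mulr_ge0 // addr_ge0 // mulr_ge0.
split=> //.
apply: (@le_trans _ _ (c * eps * (d * l p))).
  rewrite real_ler_norml ?realB // lerBrDr lerBlDr -{2}[d * l p]mul1r -{4}[d * l p]mul1r.
  by rewrite -mulNr -!mulrDl addrC v addrC u.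
have lS : l p <= \sum_p l p.
  by rewrite [leRHS](bigD1 p) //= lerDl sumr_ge0 // => i _; rewrite ltW.
rewrite [leLHS](_ : _ = c * l p * (eps * d)); last by ring.
rewrite -[leRHS]mulrA ler_wpM2r ?mulr_ge0 //.
by rewrite -[leLHS]addr0 lerD // ler_wpM2l.
Qed.

End HermitianMatrices.

Local Open Scope complex_scope.

(** * An orthonormal basis adapted to the Vandermonde flag *)

Section Flag.
Variables (r : nat -> nat) (m n : nat).
Hypothesis rm : r m = n.

(** For ranks r 0 <= r 1 <= ... <= r m = n, the basis vector of index p belongs to level k
    when it is among the first r k vectors but not among the first r (k - 1). *)
Definition level (p : nat) : nat := find (fun k => p < r k)%N (iota 0 m.+1).

Lemma level_le p : (p < n)%N -> (level p <= m)%N.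
Proof.
move=> pn; rewrite -ltnS -[X in (_ < X)%N](size_iota 0) -has_find.
by apply/hasP; exists m; rewrite ?mem_iota ?add0n ?ltnSn // rm.
Qed.

Lemma level_ub p : (p < n)%N -> (p < r (level p))%N.
Proof.
move=> pn; have lm := level_le pn.
have h : has (fun k => p < r k)%N (iota 0 m.+1) by rewrite has_find size_iota.
by have := nth_find 0 h; rewrite nth_iota.
Qed.

Lemma level_lb p k : (p < n)%N -> (k < level p)%N -> (r k <= p)%N.
Proof.
move=> pn kl; have := before_find 0 kl.
rewrite nth_iota ?add0n; first by rewrite ltnNge => /negbFE.
by rewrite ltnS ltnW // (leq_trans kl) // level_le.
Qed.

Lemma level_homo p q : (p <= q)%N -> (q < n)%N -> (level p <= level q)%N.
Proof.
move=> pq qn; rewrite leqNgt; apply/negP => /level_lb h.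
have := h (leq_ltn_trans pq qn); rewrite leqNgt.
by rewrite (leq_ltn_trans pq) // level_ub.
Qed.

End Flag.

Section Vander.
Variables (R : realType) (d n : nat) (y : 'I_n -> 'rV[R]_d).
Implicit Types a : 'I_d -> nat.

Definition monomial a (s : 'I_n) : R := \prod_(i < d) y s 0 i ^+ a i.

Definition monomial_row a : 'rV[R]_n := \row_s monomial a s.

Lemma monomial_row_sub a k : (\sum_i a i <= k)%N ->
  (monomial_row a <= (vandermonde_le y k)^T)%MS.
Proof.
move=> ak; have ai i : (a i < k.+1)%N.
  by rewrite ltnS (leq_trans _ ak) // (bigD1 i) //= leq_addr.
pose f : {ffun 'I_d -> 'I_k.+1} := [ffun i => Ordinal (ai i)].
have fm : f \in multi_index d k.
  by rewrite inE; under eq_bigr do rewrite ffunE.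
apply: (submx_trans _ (row_sub (enum_rank_in fm f) _)).
rewrite [row _ _](_ : _ = monomial_row a) //; apply/rowP => s; rewrite !mxE.
by rewrite enum_rankK_in //; apply: eq_bigr => i _; rewrite ffunE.
Qed.

Lemma vandermonde_mono k l : (k <= l)%N ->
  ((vandermonde_le y k)^T <= (vandermonde_le y l)^T)%MS.
Proof.
move=> kl; apply/row_subP => c.
pose a i : nat := (enum_val c : {ffun 'I_d -> 'I_k.+1}) i.
have -> : row c (vandermonde_le y k)^T = monomial_row a.
  by apply/rowP => s; rewrite !mxE.
apply: monomial_row_sub; apply: leq_trans kl.
by have := enum_valP c; rewrite inE.
Qed.

Lemma vandermonde_rank_mono k l : (k <= l)%N ->
  (\rank (vandermonde_le y k) <= \rank (vandermonde_le y l))%N.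
Proof.
by move=> kl; rewrite -mxrank_tr -[leqRHS]mxrank_tr mxrankS ?vandermonde_mono.
Qed.

Lemma mul_vandermonde_eq0 k (u : 'rV[R[i]]_n) :
  (forall a, (\sum_i a i <= k)%N -> \sum_s u 0 s * (monomial a s)%:C = 0) ->
  u *m map_mx (real_complex R) (vandermonde_le y k) = 0.
Proof.
move=> h; apply/rowP => c; rewrite !mxE.
pose a i : nat := (enum_val c : {ffun 'I_d -> 'I_k.+1}) i.
rewrite -[RHS](h a); last by have := enum_valP c; rewrite inE.
by apply: eq_bigr => s _; rewrite !mxE.
Qed.

Variable m : nat.
Let r k := \rank (vandermonde_le y k).
Hypothesis rm : r m = n.
Let w (p : 'I_n) := level r m p.

(** An orthonormal basis of row vectors, the first r k of which span the column space of
    V_{<= k}. A vector of level k is orthogonal to all monomials of degree below k; conversely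
    a combination of vectors of level k that is also orthogonal to the monomials of degree k is
    orthogonal to the column space it belongs to, hence vanishes. *)
Lemma flag_basis : exists2 Q : 'M[R[i]]_n, Q \is unitarymx &
  (forall p a, (\sum_i a i < w p)%N -> \sum_s Q p s * (monomial a s)%:C = 0)
  /\ (forall k (c : 'rV[R[i]]_n), (forall p, w p != k -> c 0 p = 0) ->
     (forall a, (\sum_i a i = k)%N ->
         \sum_p c 0 p * \sum_s Q p s * (monomial a s)%:C = 0) ->
     c = 0).
Proof.
pose VC k := map_mx (real_complex R) (vandermonde_le y k).
pose U (p : 'I_n) : 'M[R[i]]_n := if w p is k.+1 then <<(VC k)^T>>%MS else 0.
have rU p : (\rank (U p) <= p)%N.
  rewrite /U; case wp : (w p) => [|k]; first by rewrite mxrank0.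
  rewrite mxrank_gen mxrank_tr mxrank_map.
  by apply: (@level_lb r m n) => //; rewrite -/(w p) wp.
have [Q Qu QU] := greedy_unitary rU; exists Q => //.
have Q0 p a : (\sum_i a i < w p)%N -> \sum_s Q p s * (monomial a s)%:C = 0.
  have := QU p; rewrite /U; case: (w p) => // k kU; rewrite ltnS => ak.
  have : (map_mx (real_complex R) (monomial_row a) <= <<(VC k)^T>>)%MS.
    by rewrite genmxE /VC map_trmx map_submx monomial_row_sub.
  case/submxP => z /(congr1 (fun A => A^t*)); rewrite adjM => e.
  have {kU}: row p Q *m (map_mx (real_complex R) (monomial_row a))^t* = 0.
    by rewrite e mulmxA kU mul0mx.
  move=> /matrixP/(_ 0 0); rewrite mxE [RHS]mxE => {2}<-; apply: eq_bigr => s _.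
  by rewrite !mxE; congr (_ * _); apply/esym/conjc_real.
split=> // k c cw ck.
have ck' a : (\sum_i a i <= k)%N -> \sum_s (c *m Q) 0 s * (monomial a s)%:C = 0.
  move=> ak; under eq_bigr do rewrite mxE mulr_suml.
  rewrite exchange_big /=.
  under eq_bigr do under eq_bigr do rewrite -mulrA.
  under eq_bigr do rewrite -mulr_sumr.
  move: ak; rewrite leq_eqVlt => /orP[/eqP/ck //|ak].
  rewrite big1 // => p _; have [wp|/cw ->] := eqVneq (w p) k; last by rewrite mul0r.
  by rewrite Q0 ?mulr0 ?wp.
have kerc : (c <= kermx (Q *m VC k))%MS.
  by apply/sub_kermxP; rewrite mulmxA mul_vandermonde_eq0.
have rk : (r k <= n)%N by apply: rank_leq_row.
(* The left kernel of Q V_k has dimension n - r k and contains the coordinate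
   vectors of index >= r k, hence consists of their combinations. *)
have cop : (copid_mx (r k) <= kermx (Q *m VC k))%MS.
  apply/sub_kermxP/row_matrixP => p; rewrite row_mul row0.
  have [pk|kp] := ltnP p (r k).
    rewrite [row p _](_ : _ = 0) ?mul0mx //; apply/rowP => q; rewrite !mxE pk andbT.
    by rewrite [_ == _ :> 'I_n](_ : _ = (p == q :> nat)) // subrr.
  rewrite [row p _](_ : _ = 'e_p); last first.
    by apply/rowP => q; rewrite !mxE eqxx ltnNge kp andbF subr0 eq_sym.
  rewrite -rowE row_mul mul_vandermonde_eq0 // => a ak.
  have kw : (k < w p)%N.
    by rewrite ltnNge; apply/negP => wk; have := @level_ub r m n rm p (ltn_ord p);
       rewrite ltnNge (leq_trans _ kp) // vandermonde_rank_mono.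
  under eq_bigr do rewrite mxE.
  by rewrite Q0 // (leq_ltn_trans ak).
have : (kermx (Q *m VC k) <= (copid_mx (r k) : 'M[R[i]]_n))%MS.
  rewrite -(mxrank_leqif_sup cop) rank_copid_mx // mxrank_ker.
  rewrite (eqmxMfull _ (_ : row_full Q)) ?row_full_unit ?unitarymx_unit //.
  by rewrite mxrank_map.
move=> /(submx_trans kerc)/submxP[z cz]; apply/rowP => p; rewrite [RHS]mxE.
have [wp|/cw //] := eqVneq (w p) k.
have pk : (p < r k)%N by rewrite -wp; apply: (@level_ub r m n).
rewrite cz mxE big1 // => q _; rewrite !mxE.
have [->|] := eqVneq q p; first by rewrite !eqxx pk subrr mulr0.
by move=> qp; rewrite [_ == _](negbTE _) // sub0r oppr0 mulr0.
Qed.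

End Vander.

(** * Taylor expansion of the imaginary exponential *)

(** The mean value theorem; it turns each differentiation into one more factor x in the
    Taylor estimate. *)
Lemma bound_of_derive (R : realType) (f g : R -> R) (k : nat) :
  (forall x : R, is_derive x 1 f (g x)) -> f 0 = 0 ->
  (forall x, `|g x| <= `|x| ^+ k) -> forall x, `|f x| <= `|x| ^+ k.+1.
Proof.
move=> df f0 gk x.
have cf a b : {within `[a, b], continuous f}%classic.
  apply: derivable_within_continuous => z _.
  by have := df z => -[].
have [x0|x0|->] := ltgtP x 0; last by rewrite f0 !normr0 expr0n.
- have [c cx e] := MVT_segment (ltW x0) (fun z _ => df z) (cf _ _).
  move: e; rewrite f0 sub0r => /(congr1 Num.norm); rewrite normrN => ->.
  rewrite normrM sub0r normrN exprSr ler_wpM2r // (le_trans (gk c)) // lerXn2r ?nnegrE //.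
  by move: cx; rewrite in_itv /= => /andP[xc c0]; rewrite !ler0_norm ?(ltW x0) // lerN2.
- have [c cx e] := MVT_segment (ltW x0) (fun z _ => df z) (cf _ _).
  move: e; rewrite f0 !subr0 => ->.
  rewrite normrM exprSr ler_wpM2r // (le_trans (gk c)) // lerXn2r ?nnegrE //.
  by move: cx; rewrite in_itv /= => /andP[xc c0]; rewrite !ger0_norm // ltW.
Qed.

Section Taylor.
Variable R : realType.
Local Notation Re := complex.Re.
Local Notation Im := complex.Im.
Local Notation i := ('i%C : R[i]).

(** The Taylor polynomials of cosine and sine are kept as real and imaginary parts of the
    exponential series, so that differentiating exchanges them without a parity discussion. *)
Definition cosT k : {poly R} := \poly_(j < k) (Re (i ^+ j) / j`!%:R).
Definition sinT k : {poly R} := \poly_(j < k) (Im (i ^+ j) / j`!%:R).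

Lemma ReiM (z : R[i]) : Re (i * z) = - Im z.
Proof. by case: z => a b /=; rewrite mul0r mul1r sub0r. Qed.
Lemma ImiM (z : R[i]) : Im (i * z) = Re z.
Proof. by case: z => a b /=; rewrite mul0r mul1r add0r. Qed.

Lemma fact_div (x : R) j : x / j.+1`!%:R *+ j.+1 = x / j`!%:R.
Proof.
have h k : k.+1%:R != 0 :> R by rewrite pnatr_eq0.
have f0 : j`!%:R != 0 :> R by rewrite pnatr_eq0 -lt0n fact_gt0.
rewrite factS natrM -mulr_natr invfM mulrA mulrAC divfK //.
Qed.

Lemma deriv_cosT k : (cosT k.+1)^`() = - sinT k.
Proof.
apply/polyP => j; rewrite coef_deriv coefN !coef_poly ltnS.
case: ltnP => _; last by rewrite mul0rn oppr0.
by rewrite fact_div exprS ReiM mulNr.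
Qed.

Lemma deriv_sinT k : (sinT k.+1)^`() = cosT k.
Proof.
apply/polyP => j; rewrite coef_deriv !coef_poly ltnS.
case: ltnP => _; last by rewrite mul0rn.
by rewrite fact_div exprS ImiM.
Qed.

(** The remainders of order k + 1 vanish at 0 and their derivatives are, up to sign, the
    remainders of order k of the other function. *)
Lemma taylor_trig k (t : R) :
  `|cos t - (cosT k).[t]| <= `|t| ^+ k /\ `|sin t - (sinT k).[t]| <= `|t| ^+ k.
Proof.
elim: k t => [|k IH] t.
  rewrite /cosT /sinT !poly_def !big_ord0 !horner0 !subr0 expr0.
  have := cos2Dsin2 t; have := sqr_ge0 (cos t); have := sqr_ge0 (sin t).
  rewrite !ler_norml => h1 h2 h3; split; nra.
split.
- apply: (@bound_of_derive _ (fun t => cos t - (cosT k.+1).[t])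
     (fun t => - (sin t - (sinT k).[t]))) => [x||x].
  + have -> : - (sin x - (sinT k).[x]) = - sin x - (cosT k.+1)^`().[x].
      by rewrite deriv_cosT hornerN; ring.
    apply: is_deriveB.
  + by rewrite cos0 horner_coef0 coef_poly /= fact0 divr1 subrr.
  + by rewrite /= normrN; case: (IH x).
- apply: (@bound_of_derive _ (fun t => sin t - (sinT k.+1).[t])
     (fun t => (cos t - (cosT k).[t]))) => [x||x].
  + rewrite -deriv_sinT.
    apply: is_deriveB.
  + by rewrite sin0 horner_coef0 coef_poly /= mul0r subrr.
  + by case: (IH x).
Qed.

Definition expiT k (t : R) : R[i] := \sum_(j < k) (i * t%:C) ^+ j / j`!%:R.

Lemma expiTE k t : expiT k t = (cosT k).[t] +i* (sinT k).[t].
Proof.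
rewrite /cosT /sinT !horner_poly [RHS]complexE !rmorph_sum mulr_sumr -big_split /=.
apply: eq_bigr => j _; rewrite exprMn.
rewrite {1}[i ^+ j]complexE !rmorphM /= !fmorphV !rmorphXn !rmorph_nat.
by ring.
Qed.

Lemma expi_taylor k t : `|expi t - expiT k t| <= (2 * `|t| ^+ k)%:C.
Proof.
have [h1 h2] := taylor_trig k t.
rewrite expiTE.
have -> : expi t - ((cosT k).[t] +i* (sinT k).[t])
  = (cos t - (cosT k).[t])%:C + i * (sin t - (sinT k).[t])%:C.
  by rewrite [LHS]complexE.
apply: le_trans (ler_normD _ _) _.
have nR (x : R) : `|x%:C| = `|x|%:C by rewrite normc_def /= expr0n addr0 sqrtr_sqr.
have ni : `|i| = 1 by rewrite normc_def /= expr0n expr1n add0r sqrtr1.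
rewrite normrM ni mul1r !nR -rmorphD lecR; lra.
Qed.

Lemma expiD s t : expi (s + t) = expi s * expi t :> R[i].
Proof. by rewrite /expi cosD sinD; apply/eqP; rewrite eq_complex /= eqxx addrC eqxx. Qed.

Lemma expi0 : expi 0 = 1 :> R[i].
Proof. by rewrite /expi cos0 sin0. Qed.

Lemma expiN t : expi (- t) = (expi t)^*%R :> R[i].
Proof. by rewrite /expi cosN sinN. Qed.

Lemma expi_sum (I : Type) (r : seq I) (F : I -> R) :
  expi (\sum_(k <- r) F k) = \prod_(k <- r) expi (F k) :> R[i].
Proof. exact: (big_morph _ expiD expi0). Qed.

Lemma norm_expi t : `|expi t| = 1 :> R[i].
Proof. by rewrite normc_def /= cos2Dsin2 sqrtr1. Qed.

End Taylor.

(** * Moments of the cube and of the grid *)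

Section Moments.
Variable R : realType.

(** The mean over [-1, 1] of the a-th power: 1 / (a + 1) for even a and 0 for odd a. *)
Definition moment a : R := (1 - (-1) ^+ a.+1) / (2 * a.+1%:R).

(** Expanding the power and discarding the terms of order h ^+ 2, uniformly for x in [-1, 1];
    this is the local error of the Riemann sums below. *)
Lemma power_step a : exists2 K : R, 0 <= K & forall x h : R, `|x| <= 1 -> 0 <= h <= 1 ->
  `|(x + h) ^+ a.+1 - x ^+ a.+1 - a.+1%:R * h * x ^+ a| <= K * h ^+ 2.
Proof.
elim: a => [|a [K K0 IH]].
  exists 0 => // x h _ _; rewrite !expr1 expr0 mulr1 mul1r mul0r.
  by rewrite (_ : _ - _ - _ = 0) ?normr0 //; ring.
exists (2 * K + a.+1%:R) => [|x h x1 /andP[h0 h1]]; first by rewrite addr_ge0 // mulr_ge0.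
have -> : (x + h) ^+ a.+2 - x ^+ a.+2 - a.+2%:R * h * x ^+ a.+1 =
  (x + h) * ((x + h) ^+ a.+1 - x ^+ a.+1 - a.+1%:R * h * x ^+ a) + a.+1%:R * h ^+ 2 * x ^+ a.
  rewrite !exprS -[a.+2]addn1 natrD; ring.
apply: le_trans (ler_normD _ _) _; rewrite [leRHS]mulrDl; apply: lerD.
  rewrite normrM -[leRHS]mulrA; apply: ler_pM => //; last by apply: IH; rewrite ?h0.
  by apply: le_trans (ler_normD _ _) _; rewrite (ger0_norm h0); lra.
rewrite normrM normrX ger0_norm ?mulr_ge0 ?exprn_ge0 //.
by rewrite -[leRHS]mulr1 ler_wpM2l ?mulr_ge0 ?exprn_ge0 // exprn_ile1.
Qed.

Definition node N j : R := (j%:R - N%:R) / N%:R.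

Lemma node_le1 N (j : 'I_(2 * N).+1) : `|node N j| <= 1.
Proof.
case: N j => [|N] j; first by rewrite /node invr0 mulr0 normr0.
rewrite /node normrM normfV [`|N.+1%:R|]ger0_norm // ler_pdivrMr ?ltr0n // mul1r.
have := ltn_ord j; rewrite ltnS => h.
have : j%:R <= (2 * N.+1)%:R :> R by rewrite ler_nat.
rewrite natrM => h'; rewrite ler_norml.
have : 0 <= j%:R :> R by [].
by move: h'; move: (N.+1%:R : R) (j%:R : R) => u v; lra.
Qed.

(** Telescoping the (a + 1)-st power along the nodes compares the mean over the grid with
    the integral. The rate 1 / N matters, as it is absorbed in O(eps) when 1 / N <= eps. *)
Lemma riemann_moment a : exists2 K : R, 0 <= K & forall N, (0 < N)%N ->
  `|(2 * N)%:R^-1 * \sum_(j < (2 * N).+1) node N j ^+ a - moment a| <= K / N%:R.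
Proof.
have [K K0 step] := power_step a.
exists (K + 1) => [|N N0]; first by rewrite addr_ge0.
have N0' : 0 < N%:R :> R by rewrite ltr0n.
have N00 : N%:R != 0 :> R by rewrite gt_eqF.
set S := \sum_(j < 2 * N) node N j ^+ a.
have n2 : node N (2 * N) = 1 by rewrite /node natrM; field; rewrite N00.
have n0 : node N 0 = -1 by rewrite /node; field; rewrite N00.
have tel : \sum_(j < 2 * N) (node N j.+1 ^+ a.+1 - node N j ^+ a.+1) = 1 - (-1) ^+ a.+1.
  rewrite -(big_mkord xpredT (fun j => node N j.+1 ^+ a.+1 - node N j ^+ a.+1)).
  rewrite (telescope_sumr (fun j => node N j ^+ a.+1)) // n2 n0 expr1n //.
(* Each of the 2 N steps of length 1 / N contributes an error K / N ^ 2. *)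
have bd : `|1 - (-1) ^+ a.+1 - a.+1%:R / N%:R * S| <= 2 * K / N%:R.
  rewrite -tel /S mulr_sumr -sumrB; apply: le_trans (ler_norm_sum _ _ _) _.
  have -> : 2 * K / N%:R = \sum_(j < 2 * N) (K * (N%:R^-1) ^+ 2).
    by rewrite sumr_const card_ord -[RHS]mulr_natr natrM; field; rewrite N00.
  apply: ler_sum => j _.
  have -> : node N j.+1 = node N j + N%:R^-1.
    by rewrite /node -addn1 natrD; field; rewrite N00.
  apply: step; first by apply: (node_le1 (Ordinal (ltnW (ltn_ord j : j.+1 < (2*N).+1)%N))).
  by rewrite invr_ge0 ltW //= invf_le1 // ler1n.
rewrite big_ord_recr /= -/S.
rewrite n2 expr1n.
have a0 : a.+1%:R != 0 :> R by rewrite pnatr_eq0.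
have a1 : 1 <= a.+1%:R :> R by rewrite ler1n.
have -> : (2 * N)%:R^-1 * (S + 1) - moment a =
    - ((1 - (-1) ^+ a.+1 - a.+1%:R / N%:R * S) / (2 * a.+1%:R)) + (2 * N)%:R^-1.
  by rewrite /moment natrM; field; rewrite N00 addrC natr1 a0.
apply: le_trans (ler_normD _ _) _; rewrite normrN [leRHS]mulrDl; apply: lerD.
  rewrite normrM normfV [`|2 * _|]ger0_norm ?mulr_ge0 //.
  rewrite ler_pdivrMr; last by rewrite mulr_gt0 // ltr0n.
  apply: le_trans bd _; rewrite [leRHS](_ : _ = a.+1%:R * (2 * K / N%:R)); last by ring.
  by rewrite -[leLHS]mul1r ler_wpM2r // !mulr_ge0 // invr_ge0.
rewrite natrM normfV ger0_norm ?mulr_ge0 // mul1r lef_pV2 ?posrE ?mulr_gt0 //.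
by rewrite mulrDl mul1r lerDl.
Qed.

(** Replacing the factors of a product one after the other; used for the product over the d
    coordinates both of moments and of exponentials. *)
Lemma prod_close (F : numDomainType) (I : Type) (r : seq I) (f g : I -> F) (B delta : F) :
  1 <= B -> (forall k, `|f k| <= B) -> (forall k, `|g k| <= B) ->
  (forall k, `|f k - g k| <= delta) ->
  `|\prod_(k <- r) f k - \prod_(k <- r) g k| <= (size r)%:R * B ^+ size r * delta.
Proof.
move=> B1 fB gB fg; have B0 : 0 <= B by apply: le_trans B1.
elim: r => [|k r IH]; first by rewrite !big_nil subrr normr0 !mul0r.
have d0 : 0 <= delta by apply: le_trans (fg k).
rewrite !big_cons; set p := \prod_(_ <- _) _; set q := \prod_(_ <- _) _.
have qB : `|q| <= B ^+ size r.
  rewrite /q; elim: (r) => [|j s IHs]; first by rewrite big_nil normr1.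
  by rewrite big_cons normrM exprS; apply: ler_pM.
have -> : f k * p - g k * q = f k * (p - q) + (f k - g k) * q by ring.
apply: le_trans (ler_normD _ _) _.
rewrite !normrM /= -natr1 mulrDl mul1r mulrDl.
have Bn : 0 <= B ^+ size r by rewrite exprn_ge0.
apply: lerD.
  apply: le_trans (ler_pM _ _ (fB k) IH) _ => //.
  by rewrite exprS [leRHS](_ : _ = B * ((size r)%:R * B ^+ size r * delta)) //; ring.
apply: le_trans (ler_pM _ _ (fg k) qB) _ => //.
by rewrite mulrC ler_wpM2r // exprS ler_peMl.
Qed.

(** The form is the mean of p ^+ 2 over [-1, 1] for the polynomial p with coefficients u. *)
Lemma hankel_real_gt0 m (u : 'I_m.+1 -> R) : (exists a, u a != 0) ->
  0 < \sum_a \sum_b u a * u b * moment (a + b).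
Proof.
move=> [a0 ua0].
(* P is the primitive of p ^+ 2 vanishing at 0, and moment j is half of the
   integral of the j-th power over [-1, 1]. *)
pose p : {poly R} := \sum_a u a *: 'X^a.
pose P : {poly R} := \sum_a \sum_b (u a * u b / (a + b).+1%:R) *: 'X^((a + b).+1).
have p0 : p != 0.
  apply: contra ua0 => /eqP /polyP/(_ a0); rewrite coef0 coef_sum (bigD1 a0) //= big1.
    by rewrite coefZ coefXn eqxx mulr1 addr0 => ->.
  move=> b ba; rewrite coefZ coefXn eq_sym (_ : (b == a0 :> nat) = false) ?mulr0 //.
  exact: negbTE.
have P' : P^`() = p ^+ 2.
  rewrite expr2 {1}/p mulr_suml /P linear_sum /=; apply: eq_bigr => a _.
  rewrite linear_sum /= mulr_sumr; apply: eq_bigr => b _.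
  have -> : u a *: 'X^a * (u b *: 'X^b) = (u a * u b) *: 'X^(a + b).
    by rewrite -scalerAl -scalerAr scalerA exprD.
  rewrite derivZ derivXn -['X^_ *+ _]scaler_nat scalerA.
  by rewrite divfK ?pnatr_eq0.
have -> : \sum_a \sum_b u a * u b * moment (a + b) = (P.[1] - P.[-1]) / 2.
  rewrite /P !horner_sum -sumrB mulr_suml; apply: eq_bigr => a _.
  rewrite !horner_sum -sumrB mulr_suml; apply: eq_bigr => b _.
  rewrite !hornerZ !hornerXn expr1n /moment.
  have : (a + b).+1%:R != 0 :> R by rewrite pnatr_eq0.
  by move: ((a + b).+1%:R : R) ((-1) ^+ (a + b).+1) => z z' z0; field; rewrite z0.
rewrite divr_gt0 // subr_gt0.
have mono : {in `[-1, 1] &, {homo horner P : x y / x <= y}}.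
  by apply: ler_hornerW => x _; rewrite P' horner_exp sqr_ge0.
have in1 : (1 : R) \in `[-1, 1] by rewrite in_itv /= lexx andbT; lra.
have inN1 : (-1 : R) \in `[-1, 1] by rewrite in_itv /= lexx /=; lra.
rewrite lt_def mono ?inE ?in1 ?inN1 //; last by lra.
rewrite andbT; apply/negP => /eqP eP.
have cst x : x \in `[-1, 1] -> P.[x] = P.[-1].
  move=> xi; have /andP[x1 x2] : -1 <= x <= 1 by rewrite in_itv in xi.
  apply/eqP; rewrite eq_le (mono _ _ inN1 xi x1) andbT -eP.
  exact: (mono _ _ xi in1 x2).
(* A primitive of p ^+ 2 with equal values at -1 and 1 is constant on [-1, 1],
   so P - P(-1) has infinitely many roots, for instance all 1 / (k + 1). *)
pose q := P - P.[-1]%:P.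
have q0 : q == 0.
  apply/negPn/negP => /max_poly_roots h.
  suff : (size [seq k.+1%:R^-1 : R | k <- iota 0 (size q)] < size q)%N.
    by rewrite size_map size_iota ltnn.
  apply: h.
  - apply/allP => _ /mapP[k _ ->]; rewrite rootE /q hornerD hornerN hornerC cst ?subrr //.
    rewrite in_itv /= invf_le1 ?ltr0n // ler1n andbT.
    by apply: (@le_trans _ _ 0); rewrite ?invr_ge0 //; lra.
  - rewrite map_inj_uniq ?iota_uniq // => k l /invr_inj/eqP.
    by rewrite eqr_nat => /eqP[].
have : p ^+ 2 = 0.
  rewrite -P' -[P](subrK P.[-1]%:P) -/q (eqP q0) add0r derivC //.
by move/eqP; rewrite expf_eq0 (negPf p0) andbF.
Qed.

End Moments.

Section Tensor.
Variables (F : fieldType) (d n : nat) (T : 'M[F]_n).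

(** A tensor power of an invertible matrix is injective, its inverse being the tensor power
    of the inverse. *)
Lemma tensor_inj (c : {ffun 'I_d -> 'I_n} -> F) : T \in unitmx ->
  (forall g : {ffun 'I_d -> 'I_n}, \sum_a c a * \prod_i T (a i) (g i) = 0) ->
  forall a, c a = 0.
Proof.
move=> Tu cT b.
have -> : c b = \sum_a c a * \prod_i (T *m invmx T) (a i) (b i).
  rewrite (bigD1 b) //= [X in _ * X]big1 ?mulr1; last first.
    by move=> i _; rewrite mulmxV // mxE eqxx.
  rewrite big1 ?addr0 // => a ab.
  have /existsP[i abi] : [exists i, a i != b i].
    by rewrite -negb_forall; apply: contra ab => /forallP h; apply/eqP/ffunP => i; apply/eqP.
  by rewrite (bigD1 i) //= mulmxV // mxE (negPf abi) mul0r mulr0.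
under eq_bigr do under eq_bigr do rewrite mxE.
under eq_bigr do rewrite bigA_distr_bigA /= mulr_sumr.
rewrite exchange_big /= big1 // => g _.
under eq_bigr do rewrite big_split /= mulrA.
by rewrite -mulr_suml cT mul0r.
Qed.

End Tensor.

Section Gram.
Variable R : realType.

Definition hankel m : 'M[R[i]]_m.+1 := \matrix_(a, b) (moment R (a + b))%:C.

Lemma hankel_herm m : (hankel m)^t* = hankel m.
Proof. by apply/matrixP => a b; rewrite !mxE addnC; apply: conjc_real. Qed.

Lemma hankel_gt0 m (x : 'rV_m.+1) : x != 0 -> 0 < qform (hankel m) x.
Proof.
move=> x0; have qr := qform_real x (hankel_herm m).
pose u a := complex.Re (x 0 a); pose v a := complex.Im (x 0 a).
pose q (w : 'I_m.+1 -> R) := \sum_a \sum_b w a * w b * moment R (a + b).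
have -> : qform (hankel m) x = (q u + q v)%:C.
  rewrite -(RRe_real qr); congr (_%:C).
  have ReD : {morph @complex.Re R : z1 z2 / z1 + z2} by move=> [? ?] [? ?].
  have Re0 : complex.Re (0 : R[i]) = 0 by [].
  rewrite /q -big_split /= /qform mxE (big_morph _ ReD Re0).
  under eq_bigr do rewrite mxE mulr_suml (big_morph _ ReD Re0).
  rewrite exchange_big /=; apply: eq_bigr => a _; rewrite -big_split; apply: eq_bigr => b _.
  rewrite !mxE /u /v; case: (x 0 a) (x 0 b) => [p1 p2] [p3 p4] /=; ring.
have q0 w : 0 <= q w.
  have [h|] := boolP [exists a, w a != 0].
    by apply/ltW/hankel_real_gt0/existsP.
  rewrite negb_exists => /forallP h; rewrite /q big1 // => a _; rewrite big1 // => b _.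
  by have := h a; rewrite negbK => /eqP ->; rewrite !mul0r.
rewrite -[0]/(0%:C) ltcR.
have [/existsP/hankel_real_gt0 h|] := boolP [exists a, u a != 0]; first by rewrite ltr_wpDr.
rewrite negb_exists => /forallP hu.
rewrite ltr_wpDl //; apply: hankel_real_gt0; apply/existsP; apply: contraR x0.
rewrite negb_exists => /forallP hv; apply/eqP/rowP => a; rewrite mxE; apply/eqP.
by rewrite eq_complex; have := hu a; have := hv a; rewrite !negbK => -> ->.
Qed.

Variables (d m n : nat) (A : 'I_n -> {ffun 'I_d -> 'I_m.+1} -> R[i]).

(** The Gram matrix, for the mean over the cube [-1, 1]^d, of the polynomials with coefficient
    families A p. *)
Definition moment_gram : 'M[R[i]]_n := \matrix_(p, q)
  \sum_a \sum_b A p a * (A q b)^*%R * (\prod_i moment R (a i + b i))%:C.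

(** The moments of the cube are products of moments of the interval, so a factor T of the
    Hankel matrix gives, by its tensor power, a factor of the moments of the cube. *)
Lemma moment_gram_factor : exists2 T : 'M[R[i]]_m.+1, T \in unitmx &
  moment_gram = \matrix_(p, q) \sum_(g : {ffun 'I_d -> 'I_m.+1})
     (\sum_a A p a * \prod_i T (a i) (g i)) * (\sum_a A q a * \prod_i T (a i) (g i))^*%R.
Proof.
have [T [Tu HT _]] := pd_lower_factor (hankel_herm m) (@hankel_gt0 m).
exists T => //; apply/matrixP => p q; rewrite !mxE.
under [RHS]eq_bigr do rewrite mulr_suml.
rewrite [RHS]exchange_big /=; apply: eq_bigr => a _.
under [RHS]eq_bigr do rewrite rmorph_sum mulr_sumr.
rewrite [RHS]exchange_big /=; apply: eq_bigr => b _.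
under [RHS]eq_bigr do rewrite rmorphM mulrACA rmorph_prod -big_split /=.
rewrite -mulr_sumr; congr (_ * _).
rewrite rmorph_prod; transitivity (\prod_i \sum_j T (a i) j * (T (b i) j)^*%R).
  apply: eq_bigr => i _; have := congr1 (fun M : 'M_ _ => M (a i) (b i)) HT.
  rewrite !mxE => h; rewrite [LHS]h.
  by apply: eq_bigr => j _; rewrite !mxE.
by rewrite bigA_distr_bigA.
Qed.

Lemma moment_gram_herm : moment_gram^t* = moment_gram.
Proof.
have [T Tu ->] := moment_gram_factor; apply/matrixP => p q; rewrite !mxE rmorph_sum.
by apply: eq_bigr => g _; rewrite rmorphM /= conjCK mulrC.
Qed.

(** Linearly independent polynomials have a positive definite Gram matrix over the cube. *)
Lemma moment_gram_gt0 :
  (forall x : 'rV_n, (forall a, \sum_p x 0 p * A p a = 0) -> x = 0) ->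
  forall x, x != 0 -> 0 < qform moment_gram x.
Proof.
move=> Ainj x x0; have [T Tu ->] := moment_gram_factor.
pose z g := \sum_p x 0 p * \sum_a A p a * \prod_i T (a i) (g i).
have -> : qform (\matrix_(p, q) \sum_(g : {ffun 'I_d -> 'I_m.+1})
     (\sum_a A p a * \prod_i T (a i) (g i)) * (\sum_a A q a * \prod_i T (a i) (g i))^*%R) x
   = \sum_(g : {ffun 'I_d -> 'I_m.+1}) `|z g| ^+ 2.
  rewrite /qform mxE.
  under eq_bigr do rewrite mxE mulr_suml.
  under eq_bigr do under eq_bigr do rewrite !mxE mulr_sumr mulr_suml.
  under eq_bigr do rewrite exchange_big /=.
  rewrite exchange_big /=; apply: eq_bigr => g _.
  rewrite normCK /z rmorph_sum mulr_sumr; apply: eq_bigr => q _.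
  rewrite mulr_suml; apply: eq_bigr => p _.
  by rewrite rmorphM; ring.
rewrite lt_def sumr_ge0 ?andbT => [|g _]; last by rewrite exprn_ge0.
apply: contra x0; rewrite psumr_eq0 => [/allP h|g _]; last by rewrite exprn_ge0.
apply/eqP/Ainj; apply: (tensor_inj Tu) => g.
have /= := h g (mem_index_enum g); rewrite expf_eq0 normr_eq0 /= => /eqP zg; rewrite -[RHS]zg.
rewrite /z; under [RHS]eq_bigr do rewrite mulr_sumr.
rewrite exchange_big /=; apply: eq_bigr => a _; rewrite mulr_suml.
by apply: eq_bigr => p _; rewrite mulrA.
Qed.

End Gram.

Lemma norm_real_complex (R : realType) (x : R) : `|x%:C| = `|x|%:C :> R[i].
Proof. by rewrite normc_def /= expr0n addr0 sqrtr_sqr. Qed.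

Lemma real_complex_ge0 (R : realType) (x : R) : (0 <= x%:C :> R[i]) = (0 <= x).
Proof. by rewrite -[0 in LHS]/(0%:C) lecR. Qed.

Section Riemann.
Variable R : realType.

Lemma riemann_moment_unif M : exists2 K : R, 0 <= K & forall a N, (a <= M)%N -> (0 < N)%N ->
  `|(2 * N)%:R^-1 * \sum_(j < (2 * N).+1) node R N j ^+ a - moment R a| <= K / N%:R.
Proof.
elim: M => [|M [K K0 IH]].
  by have [K K0 H] := riemann_moment R 0; exists K => // a N; rewrite leqn0 => /eqP-> /H.
have [L L0 H] := riemann_moment R M.+1; exists (K + L) => [|a N aM N0].
  by rewrite addr_ge0.
have i0 : 0 <= N%:R^-1 :> R by rewrite invr_ge0.
move: aM; rewrite leq_eqVlt => /orP[/eqP->|aM].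
  by apply: le_trans (H _ N0) _; rewrite mulrDl lerDr mulr_ge0.
by apply: le_trans (IH _ _ _ N0) _ => //; rewrite mulrDl lerDl mulr_ge0.
Qed.

(** The mean of a monomial over the grid factors into means over the coordinates. *)
Lemma riemann_moment_multi d m : exists2 K : R, 0 <= K &
  forall (a b : {ffun 'I_d -> 'I_m.+1}) N, (0 < N)%N ->
  `|((2 * N) ^ d)%N%:R^-1 * \sum_(g : {ffun 'I_d -> 'I_(2 * N).+1})
       \prod_i node R N (g i) ^+ (a i + b i) - \prod_i moment R (a i + b i)| <= K / N%:R.
Proof.
have [K K0 H] := riemann_moment_unif (m + m).
pose S : R := \sum_(c < (m + m).+1) `|moment R c|.
have S0 : 0 <= S by rewrite sumr_ge0.
have mS (a b : 'I_m.+1) : `|moment R (a + b)| <= S.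
  have ab : (a + b < (m + m).+1)%N by rewrite ltnS leq_add // -ltnS.
  by rewrite /S (bigD1 (Ordinal ab)) //= lerDl sumr_ge0.
pose B := 1 + S + K.
exists (d%:R * B ^+ d * K) => [|a b N N0].
  by rewrite !mulr_ge0 // exprn_ge0 // !addr_ge0.
have -> : ((2 * N) ^ d)%N%:R^-1 * \sum_(g : {ffun 'I_d -> 'I_(2 * N).+1})
       \prod_i node R N (g i) ^+ (a i + b i) =
   \prod_i ((2 * N)%:R^-1 * \sum_(j < (2 * N).+1) node R N j ^+ (a i + b i)).
  rewrite big_split /= prodr_const card_ord natrX exprVn; congr (_ * _).
  by rewrite bigA_distr_bigA.
have N1 : 1 <= N%:R :> R by rewrite ler1n.
have KN : K / N%:R <= K.
  by rewrite ler_pdivrMr ?(lt_le_trans _ N1) // -[leLHS]mulr1 ler_wpM2l.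
have ab i : (a i + b i <= m + m)%N by rewrite leq_add // -ltnS.
have := @prod_close R 'I_d (index_enum 'I_d)
  (fun i => (2 * N)%:R^-1 * \sum_(j < (2 * N).+1) node R N j ^+ (a i + b i))
  (fun i => moment R (a i + b i)) B (K / N%:R).
have -> : size (index_enum 'I_d) = d by rewrite -[RHS](card_ord d) cardE enumT.
rewrite -[d%:R * _ * K / _]mulrA; apply.
- by rewrite /B -addrA lerDl addr_ge0.
- move=> i; rewrite -[X in `|X|](subrK (moment R (a i + b i))).
  apply: le_trans (ler_normD _ _) _; have := H _ N (ab i) N0; have := mS (a i) (b i).
  rewrite /B; move: `|_| `|_| KN => u v; lra.
- by move=> i; apply: le_trans (mS _ _) _; rewrite /B addrAC lerDr addr_ge0.
- by move=> i; apply: H.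
Qed.

End Riemann.

(** * Expansion of the waves in the adapted basis *)

Section TaylorMulti.
Variable R : realType.
Local Notation i := ('i%C : R[i]).

Lemma norm_i : `|i| = 1.
Proof. by rewrite normc_def /= expr0n expr1n add0r sqrtr1. Qed.

(** The coefficient of the monomial of exponent a in exp(i (t_1 + ... + t_d)). *)
Definition taylor_coef d m (a : {ffun 'I_d -> 'I_m.+1}) : R[i] :=
  i ^+ (\sum_k a k) * (\prod_k (a k)`!%:R^-1).

(** Truncating each coordinate, rather than the exponential of the sum, produces the
    multi-index expansion without multinomial coefficients. *)
Lemma prod_expiT d m (e : R) (u v : 'I_d -> R) :
  \prod_k expiT m.+1 (e * u k * v k) =
  \sum_(a : {ffun 'I_d -> 'I_m.+1}) e%:C ^+ (\sum_k a k) *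
     (taylor_coef a * (\prod_k v k ^+ a k)%:C) * (\prod_k u k ^+ a k)%:C.
Proof.
rewrite /expiT bigA_distr_bigA; apply: eq_bigr => a _.
rewrite /taylor_coef -!prodrXr !rmorph_prod -!big_split; apply: eq_bigr => k _ /=.
rewrite !rmorphM !rmorphXn /= !exprMn; ring.
Qed.

Lemma expi_multi_taylor d m (P : R) : 0 <= P -> exists2 K : R, 0 <= K &
  forall (t : 'I_d -> R) (e : R), 0 <= e <= 1 -> (forall k, `|t k| <= P * e) ->
  `|\prod_k expi (t k) - \prod_k expiT m.+1 (t k)| <= (K * e ^+ m.+1)%:C.
Proof.
move=> P0; pose L : R := 2 * P ^+ m.+1; have L0 : 0 <= L by rewrite mulr_ge0 ?exprn_ge0.
pose B := 1 + L; have B0 : 0 <= B by rewrite addr_ge0.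
exists (d%:R * B ^+ d * L) => [|t e /andP[e0 e1] tP]; first by rewrite !mulr_ge0 ?exprn_ge0.
have h k : `|expi (t k) - expiT m.+1 (t k)| <= (L * e ^+ m.+1)%:C.
  apply: le_trans (expi_taylor _ _) _; rewrite lecR /L -mulrA -exprMn ler_wpM2l //.
  by rewrite lerXn2r ?nnegrE ?mulr_ge0.
have := @prod_close R[i] 'I_d (index_enum 'I_d) (fun k => expi (t k))
  (fun k => expiT m.+1 (t k)) B%:C ((L * e ^+ m.+1)%:C).
have -> : size (index_enum 'I_d) = d by rewrite -[RHS](card_ord d) cardE enumT.
have -> : (d%:R * B ^+ d * L * e ^+ m.+1)%:C = d%:R * B%:C ^+ d * (L * e ^+ m.+1)%:C.
  by rewrite -[d%:R * _ * L * _]mulrA !rmorphM !rmorphXn !rmorph_nat.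
have Le : L * e ^+ m.+1 <= L by rewrite -[leRHS]mulr1 ler_wpM2l // exprn_ile1.
apply=> //.
- by rewrite -[1]/(1%:C) lecR /B lerDl.
- by move=> k; rewrite norm_expi -[1]/(1%:C) lecR /B lerDl.
- move=> k; rewrite -[expiT _ _](subKr (expi (t k))).
  apply: le_trans (ler_normB _ _) _; rewrite norm_expi.
  apply: le_trans (lerD (lexx _) (h k)) _.
  by rewrite -[1]/(1%:C) -rmorphD lecR /B lerD2l.
Qed.

End TaylorMulti.

Section Leading.
Variables (R : realType) (d n m : nat) (y : 'I_n -> 'rV[R]_d).
Variables (Q : 'M[R[i]]_n) (w : 'I_n -> nat).

(** The pairing of basis vector p with the column of exponent a of the Vandermonde matrix. *)
Definition flag_moment p (a : {ffun 'I_d -> 'I_m.+1}) : R[i] :=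
  \sum_s Q p s * (monomial y (fun i => a i) s)%:C.

(** The Taylor coefficients of basis vector p in the degree equal to its level, the lowest
    degree in which they can be nonzero. *)
Definition leading_coef p (a : {ffun 'I_d -> 'I_m.+1}) : R[i] :=
  if (\sum_i a i == w p)%N then taylor_coef R a * flag_moment p a else 0.

Variables (N : nat).
Implicit Type g : {ffun 'I_d -> 'I_(2 * N).+1}.

(** The entry of the matrix U at frequency g - N and node s, for e = N Delta. *)
Definition wave (e : R) g s : R[i] := \prod_k expi (e * y s 0 k * node R N (g k)).

Definition flag_wave (e : R) g p : R[i] := \sum_s Q p s * wave e g s.

Definition node_monomial g (a : {ffun 'I_d -> 'I_m.+1}) : R :=
  \prod_k node R N (g k) ^+ a k.

Definition leading_part g p : R[i] :=
  \sum_a leading_coef p a * (node_monomial g a)%:C.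

End Leading.

Section Estimate.
Variables (R : realType) (d n m : nat) (y : 'I_n -> 'rV[R]_d).
Variables (Q : 'M[R[i]]_n) (w : 'I_n -> nat) (P : R).
Hypothesis Q0 : forall p a, (\sum_i a i < w p)%N ->
  \sum_s Q p s * (monomial y a s)%:C = 0.
Hypothesis wm : forall p, (w p <= m)%N.
Hypothesis P0 : 0 <= P.
Hypothesis yP : forall s i, `|y s 0 i| <= P.
Local Notation lead := (leading_coef (m := m) y Q w).

Lemma node_monomial_le1 N (g : {ffun 'I_d -> 'I_(2 * N).+1}) (a : {ffun 'I_d -> 'I_m.+1}) :
  `|(node_monomial R g a)%:C| <= 1 :> R[i].
Proof.
rewrite norm_real_complex -[1]/(1%:C) lecR /node_monomial.
elim/big_rec: _ => [|k x _ IH]; first by rewrite normr1.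
by rewrite normrM normrX mulr_ile1 ?exprn_ge0 ?exprn_ile1 // node_le1.
Qed.

(** Taylor expansion of a basis vector of level w p applied to a wave: the terms of degree
    below w p vanish by the choice of the basis, so the sum is e ^+ w p times its leading
    part, up to a relative error O(e) that is uniform in the frequency. *)
Lemma flag_wave_leading : exists2 K : R[i], 0 <= K & forall (e : R) N
   (g : {ffun 'I_d -> 'I_(2 * N).+1}) p, 0 < e <= 1 ->
  `|flag_wave y Q e g p - e%:C ^+ w p * leading_part m y Q w g p| <= K * e%:C * e%:C ^+ w p
  /\ `|leading_part m y Q w g p| <= K.
Proof.
have [K1 K10 HT] := @expi_multi_taylor R d m P P0.
pose S1 : R[i] := \sum_p \sum_s `|Q p s|.
pose S2 : R[i] := \sum_p \sum_(a : {ffun 'I_d -> 'I_m.+1}) `|taylor_coef R a * flag_moment y Q p a|.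
have S10 : 0 <= S1 by rewrite !sumr_ge0 // => p _; rewrite sumr_ge0.
have S20 : 0 <= S2 by rewrite !sumr_ge0 // => p _; rewrite sumr_ge0.
have K1C : 0 <= K1%:C by rewrite real_complex_ge0.
have S1p p : \sum_s `|Q p s| <= S1.
  by rewrite [leRHS](bigD1 p) //= lerDl sumr_ge0 // => q _; rewrite sumr_ge0.
have S2p p : \sum_(a : {ffun 'I_d -> 'I_m.+1}) `|taylor_coef R a * flag_moment y Q p a| <= S2.
  by rewrite [leRHS](bigD1 p) //= lerDl sumr_ge0 // => q _; rewrite sumr_ge0.
have lp p a : `|lead p a| <= `|taylor_coef R a * flag_moment y Q p a|.
  by rewrite /leading_coef; case: ifP => // _; rewrite normr0.
exists (S1 * K1%:C + S2) => [|e N g p /andP[e0 e1]]; first by rewrite addr_ge0 // mulr_ge0.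
have e00 := ltW e0.
have eC0 : 0 <= e%:C by rewrite real_complex_ge0.
have eC1 : e%:C <= 1 by rewrite -[1]/(1%:C) lecR.
split; last first.
  apply: (@le_trans _ _ S2); last by rewrite lerDr mulr_ge0.
  apply: le_trans (S2p p); apply: le_trans (ler_norm_sum _ _ _) _.
  apply: ler_sum => a _; rewrite normrM -[leRHS]mulr1.
  by apply: ler_pM => //; apply: node_monomial_le1.
pose TT s := \prod_k expiT m.+1 (e * y s 0 k * node R N (g k)).
have -> : flag_wave y Q e g p - e%:C ^+ w p * leading_part m y Q w g p =
   \sum_s Q p s * (wave y e g s - TT s) +
   (\sum_s Q p s * TT s - e%:C ^+ w p * leading_part m y Q w g p).
  rewrite addrA; congr (_ - _); rewrite -big_split; apply: eq_bigr => s _ /=.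
  by rewrite mulrBr subrK.
apply: le_trans (ler_normD _ _) _; rewrite mulrDl mulrDl; apply: lerD.
  apply: le_trans (ler_norm_sum _ _ _) _.
  apply: (@le_trans _ _ (S1 * (K1 * e ^+ m.+1)%:C)).
    apply: le_trans (ler_wpM2r _ (S1p p)); last first.
      by rewrite real_complex_ge0 mulr_ge0 // exprn_ge0.
    rewrite mulr_suml; apply: ler_sum => s _; rewrite normrM; apply: ler_wpM2l => //.
    apply: HT => [|k]; first by rewrite e00.
    rewrite normrM normrM (ger0_norm e00) -[leRHS]mulr1.
    apply: ler_pM => //; [exact: mulr_ge0| |exact: node_le1].
    by rewrite mulrC ler_wpM2r.
  rewrite rmorphM rmorphXn /= -!mulrA ler_wpM2l // ler_wpM2l //.
  by rewrite -exprS ler_wiXn2l // ltnS.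
have -> : \sum_s Q p s * TT s =
   \sum_(a : {ffun 'I_d -> 'I_m.+1}) e%:C ^+ (\sum_k a k) *
     (taylor_coef R a * flag_moment y Q p a * (node_monomial R g a)%:C).
  rewrite /TT; under eq_bigr do rewrite prod_expiT mulr_sumr.
  rewrite exchange_big /=; apply: eq_bigr => a _.
  rewrite /flag_moment mulr_sumr mulr_suml mulr_sumr; apply: eq_bigr => s _.
  by rewrite /monomial /node_monomial; ring.
rewrite /leading_part mulr_sumr -sumrB.
apply: le_trans (ler_norm_sum _ _ _) _.
rewrite -mulrA; apply: le_trans (ler_wpM2r _ (S2p p)); last by rewrite mulr_ge0 ?exprn_ge0.
rewrite mulr_suml; apply: ler_sum => a _.
rewrite mulrA [X in _ - X]mulrA -mulrBl normrM -[leRHS]mulr1.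
apply: ler_pM => //; last exact: node_monomial_le1.
(* Degrees below w p are annihilated by row p of Q, degree w p is the leading
   part, and higher degrees carry at least one more factor e. *)
rewrite /leading_coef; case: ltngtP => h.
- rewrite mulr0 subr0 (_ : flag_moment _ _ _ _ = 0) ?mulr0 ?normr0 ?mul0r //.
  exact: Q0.
- rewrite mulr0 subr0 normrM mulrC ler_wpM2l // ger0_norm ?exprn_ge0 //.
  by rewrite -exprS ler_wiXn2l.
- by rewrite h subrr normr0 !mulr_ge0 ?exprn_ge0.
Qed.

End Estimate.

(** * The Dirichlet matrix *)

Section GridWeight.
Variables (R : realType) (d : nat).

Definition grid_weight N : R[i] := ((2 * N) ^ d)%N%:R^-1.

Lemma grid_weight_ge0 N : 0 <= grid_weight N.
Proof. by rewrite invr_ge0. Qed.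

Lemma grid_weight_card N (F : {ffun 'I_d -> 'I_(2 * N).+1} -> R[i]) (K : R[i]) :
  (0 < N)%N -> 0 <= K -> (forall g, `|F g| <= K) ->
  `|grid_weight N * \sum_g F g| <= 2 ^+ d * K.
Proof.
move=> N0 K0 FK; rewrite normrM (ger0_norm (grid_weight_ge0 N)) /grid_weight.
rewrite mulrC ler_pdivrMr ?ltr0n ?expn_gt0 ?muln_gt0 ?N0 //.
apply: le_trans (ler_norm_sum _ _ _) _.
apply: le_trans (ler_sum _ (fun g _ => FK g)) _.
rewrite sumr_const card_ffun !card_ord -[leLHS]mulr_natl [leRHS]mulrAC ler_wpM2r //.
rewrite -natrX -natrM ler_nat -expnMn.
have h : ((2 * N).+1 <= 2 * (2 * N))%N by lia.
by case: (d) => // d'; rewrite leq_exp2r.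
Qed.

End GridWeight.

Lemma dirichlet_wave (R : realType) (d n N : nat) (y : 'I_n -> 'rV[R]_d) (Delta : R) p q :
  (0 < N)%N ->
  dirichlet_matrix N (scaled Delta y) p q = grid_weight R d N *
    \sum_(g : {ffun 'I_d -> 'I_(2 * N).+1})
       wave y (N%:R * Delta) g p * (wave y (N%:R * Delta) g q)^*%R.
Proof.
move=> N0; have N00 : N%:R != 0 :> R by rewrite pnatr_eq0 -lt0n.
rewrite mxE; congr (_ * _); apply: eq_bigr => g _.
rewrite /wave rmorph_prod -big_split /dotv expi_sum; apply: eq_bigr => k _ /=.
rewrite -expiN -expiD /scaled !mxE; congr expi; rewrite /node; field.
by rewrite N00.
Qed.

Section Dirichlet.
Variables (R : realType) (d n : nat) (y : 'I_n -> 'rV[R]_d).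

(** The form of D_N is a mean of squares, since D_N = (2 N)^(-d) adj(U) U. *)
Lemma dirichlet_qform N (Delta : R) x : (0 < N)%N ->
  qform (dirichlet_matrix N (scaled Delta y)) x = grid_weight R d N *
    \sum_(g : {ffun 'I_d -> 'I_(2 * N).+1})
       `|\sum_s x 0 s * wave y (N%:R * Delta) g s| ^+ 2.
Proof.
move=> N0; rewrite /qform mxE; under eq_bigr do rewrite mxE mulr_suml.
under eq_bigr do under eq_bigr do rewrite dirichlet_wave // !mxE.
under eq_bigr do under eq_bigr do rewrite mulrCA -mulrA mulr_sumr mulr_suml.
under eq_bigr do rewrite -mulr_sumr exchange_big /=.
rewrite -mulr_sumr exchange_big /=; congr (_ * _); apply: eq_bigr => g _.
rewrite normCK rmorph_sum mulr_sumr; apply: eq_bigr => q _; rewrite mulr_suml.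
by apply: eq_bigr => p _; rewrite rmorphM; ring.
Qed.

Lemma dirichlet_herm N (Delta : R) : (0 < N)%N ->
  (dirichlet_matrix N (scaled Delta y))^t* = dirichlet_matrix N (scaled Delta y).
Proof.
move=> N0; apply/matrixP => p q; rewrite 2!mxE !dirichlet_wave //.
rewrite rmorphM /= rmorph_sum /grid_weight fmorphV /= conjC_nat; congr (_ * _).
by apply: eq_bigr => g _; rewrite rmorphM /= conjCK mulrC.
Qed.

Lemma norm_wave N (e : R) (g : {ffun 'I_d -> 'I_(2 * N).+1}) s : `|wave y e g s| = 1.
Proof.
by rewrite /wave normr_prod big1 // => k _; exact: norm_expi.
Qed.

(** The Dirichlet matrix is positive semidefinite and its entries are at most 2 ^+ d,
    whatever N and Delta are. *)
Lemma dirichlet_eigen_bounded : exists2 K : R[i], 0 <= K & forall N (Delta : R), (0 < N)%N ->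
  exists2 lam : 'I_n -> R[i],
    char_poly (dirichlet_matrix N (scaled Delta y)) = \prod_p ('X - (lam p)%:P)
    & forall p, 0 <= lam p <= K.
Proof.
have [K K0 H] := perturb_form_le (unitmx1 R[i] n).
have K20 : 0 <= K * 2 ^+ d by rewrite mulr_ge0 ?exprn_ge0.
exists (K * 2 ^+ d) => // N Delta N0.
set D := dirichlet_matrix N _.
have adj1 : (1%:M : 'M[R[i]]_n)^t* = 1%:M by rewrite trmx1 map_mx1.
have Dh : D^t* = D by apply: dirichlet_herm.
have D1 p q : `|D p q| <= 2 ^+ d.
  rewrite /D dirichlet_wave // -[leRHS]mulr1; apply: grid_weight_card => // g.
  by rewrite normrM norm_conjC !norm_wave mulr1.
have qD x : 0 <= qform D x.
  rewrite /D dirichlet_qform // mulr_ge0 ?grid_weight_ge0 // sumr_ge0 // => g _.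
  exact: exprn_ge0.
have [||lam cl lb] := @eigen_compare _ n D 1%:M (fun=> 1) 0 (K * 2 ^+ d) Dh adj1 (lexx 0) K20.
- rewrite char_poly_trig ?scalar_mx_is_trig //; apply: eq_bigr => p _.
  by rewrite mxE eqxx.
- move=> x; rewrite mul0r qD /=; apply: le_trans (real_ler_norm _) _.
    exact: qform_real.
  by have := H D _ D1 x; rewrite adj1 mulmx1.
by exists lam => // p; have := lb p; rewrite mul0r mulr1.
Qed.

End Dirichlet.

Section Graded.
Variables (R : realType) (d n m : nat) (y : 'I_n -> 'rV[R]_d).
Variables (Q : 'M[R[i]]_n) (w : 'I_n -> nat) (P : R).
Hypothesis Q0 : forall p a, (\sum_i a i < w p)%N ->
  \sum_s Q p s * (monomial y a s)%:C = 0.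
Hypothesis wm : forall p, (w p <= m)%N.
Hypothesis P0 : 0 <= P.
Hypothesis yP : forall s i, `|y s 0 i| <= P.
Local Notation lead := (leading_coef (m := m) y Q w).
Local Notation G := (moment_gram lead).

(** The discrete Gram matrix of the leading parts converges to their Gram matrix over the
    cube, one moment at a time. *)
Lemma gram_discrete_close : exists2 K : R[i], 0 <= K & forall N p q, (0 < N)%N ->
  `|grid_weight R d N * (\sum_(g : {ffun 'I_d -> 'I_(2 * N).+1})
      leading_part m y Q w g p * (leading_part m y Q w g q)^*%R) - G p q| <= K * (N%:R^-1)%:C.
Proof.
have [K K0 H] := riemann_moment_multi R d m.
have KC : 0 <= K%:C by rewrite real_complex_ge0.
pose S (p q : 'I_n) := \sum_a \sum_b `|lead p a| * `|lead q b|.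
have S0 p q : 0 <= S p q.
  by rewrite sumr_ge0 // => a _; rewrite sumr_ge0 // => b _; rewrite mulr_ge0.
have SS p q : S p q <= \sum_p \sum_q S p q.
  apply: (@le_trans _ _ (\sum_q S p q)).
    by rewrite [leRHS](bigD1 q) //= lerDl sumr_ge0.
  by rewrite [leRHS](bigD1 p) //= lerDl sumr_ge0 // => j _; rewrite sumr_ge0.
exists ((\sum_p \sum_q S p q) * K%:C) => [|N p q N0].
  by rewrite mulr_ge0 // sumr_ge0 // => p _; rewrite sumr_ge0.
have i0 : 0 <= (N%:R^-1)%:C :> R[i] by rewrite real_complex_ge0 invr_ge0.
pose X (a b : {ffun 'I_d -> 'I_m.+1}) : R := ((2 * N) ^ d)%N%:R^-1 *
  \sum_(g : {ffun 'I_d -> 'I_(2 * N).+1}) \prod_i node R N (g i) ^+ (a i + b i).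
have -> : grid_weight R d N * (\sum_(g : {ffun 'I_d -> 'I_(2 * N).+1})
      leading_part m y Q w g p * (leading_part m y Q w g q)^*%R) =
   \sum_a \sum_b lead p a * (lead q b)^*%R * (X a b)%:C.
  rewrite /leading_part.
  under eq_bigr do rewrite mulr_suml.
  rewrite exchange_big mulr_sumr /=; apply: eq_bigr => a _.
  under eq_bigr do rewrite rmorph_sum mulr_sumr.
  rewrite exchange_big mulr_sumr /=; apply: eq_bigr => b _.
  rewrite /X rmorphM fmorphV rmorph_nat -/(grid_weight R d N) rmorph_sum /= mulrCA.
  congr (_ * _); rewrite mulr_sumr; apply: eq_bigr => g _.
  rewrite rmorphM /= [((node_monomial _ _ _)%:C)^*%R](conjc_real (node_monomial R g b)).
  rewrite mulrACA -rmorphM; congr (_ * _%:C).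
  by rewrite /node_monomial -big_split; apply: eq_bigr => k _; rewrite /= exprD.
rewrite mxE -sumrB; apply: le_trans (ler_norm_sum _ _ _) _.
apply: (@le_trans _ _ (S p q * (K%:C * (N%:R^-1)%:C))); last first.
  by rewrite -mulrA ler_wpM2r // mulr_ge0.
rewrite /S mulr_suml; apply: ler_sum => a _.
rewrite -sumrB mulr_suml; apply: le_trans (ler_norm_sum _ _ _) _; apply: ler_sum => b _.
rewrite -mulrBr !normrM norm_conjC; apply: ler_wpM2l; first by rewrite mulr_ge0.
by rewrite -rmorphB norm_real_complex -rmorphM lecR /=; exact: H.
Qed.

(** In the adapted basis the Dirichlet matrix is graded: dividing the entry of index (p, q) by
    eps ^+ (w p + w q) leaves the Gram matrix of the leading parts, up to O(eps). The condition
    1 / N <= eps is what makes the discretization error part of O(eps). *)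
Lemma dirichlet_graded : exists2 K : R[i], 0 <= K & forall N (Delta : R),
  (0 < N)%N -> 0 < N%:R * Delta <= 1 -> N%:R^-1 <= N%:R * Delta ->
  exists B : 'M[R[i]]_n, [/\ B^t* = B,
    forall p q, `|B p q - G p q| <= K * (N%:R * Delta)%:C &
    let E := grading w (N%:R * Delta)%:C in
    Q *m dirichlet_matrix N (scaled Delta y) *m Q^t* = E *m B *m E].
Proof.
have [K1 K10 H1] := gram_discrete_close.
have [K2 K20 H2] := flag_wave_leading Q0 wm P0 yP.
exists (2 ^+ d * (3 * K2 ^+ 2) + K1) => [|N Delta N0 /[dup] e01 /andP[e0 e1] Ne].
  by rewrite addr_ge0 // !mulr_ge0 ?exprn_ge0.
set e := N%:R * Delta in e01 e0 e1 Ne *; set D := dirichlet_matrix _ _.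
have eC0 : 0 < e%:C by rewrite -[0]/(0%:C) ltcR.
have eC00 := ltW eC0.
have eC1 : e%:C <= 1 by rewrite -[1]/(1%:C) lecR.
have en k : e%:C ^+ k != 0 by rewrite expf_neq0 // gt_eqF.
have ec k : ((e%:C ^+ k)^*)%R = e%:C ^+ k.
  by apply/CrealP/realX; rewrite ger0_real.
have QD p q : (Q *m D *m Q^t*) p q = grid_weight R d N *
    \sum_(g : {ffun 'I_d -> 'I_(2 * N).+1}) flag_wave y Q e g p * (flag_wave y Q e g q)^*%R.
  rewrite mxE; under eq_bigr do rewrite mxE mulr_suml.
  under eq_bigr do under eq_bigr do rewrite /D dirichlet_wave // !mxE.
  under eq_bigr do under eq_bigr do rewrite mulrCA -mulrA mulr_sumr mulr_suml.
  under eq_bigr do rewrite -mulr_sumr exchange_big /=.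
  rewrite -mulr_sumr exchange_big /=; congr (_ * _); apply: eq_bigr => g _.
  rewrite /flag_wave rmorph_sum mulr_sumr; apply: eq_bigr => t _; rewrite mulr_suml.
  by apply: eq_bigr => s _; rewrite rmorphM /=; ring.
pose B := \matrix_(p, q) ((Q *m D *m Q^t*) p q / (e%:C ^+ w p * e%:C ^+ w q)).
have Dh : D^t* = D by apply: dirichlet_herm.
have QDh : (Q *m D *m Q^t*)^t* = Q *m D *m Q^t* by rewrite !adjM trmxCK Dh mulmxA.
exists B; split; last first.
- apply/matrixP => p q; rewrite gradingE [B p q]mxE.
  by field; rewrite !en.
- move=> p q; rewrite -[B p q](subrK (grid_weight R d N *
    (\sum_(g : {ffun 'I_d -> 'I_(2 * N).+1})
      leading_part m y Q w g p * (leading_part m y Q w g q)^*%R))).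
  rewrite -addrA; apply: le_trans (ler_normD _ _) _; rewrite mulrDl; apply: lerD; last first.
    apply: le_trans (H1 _ _ _ N0) _; apply: ler_wpM2l => //; by rewrite lecR.
  rewrite mxE QD -mulrA -mulrBr mulr_suml -sumrB -[leRHS]mulrA.
  apply: grid_weight_card => // [|g]; first by rewrite !mulr_ge0 ?exprn_ge0.
  have [b1 a1] := H2 e N g p e01; have [b2 a2] := H2 e N g q e01.
  set fp := flag_wave _ _ _ _ p in b1 *; set fq := flag_wave _ _ _ _ q in b2 *.
  set ap := leading_part _ _ _ _ _ p in b1 a1 *; set aq := leading_part _ _ _ _ _ q in b2 a2 *.
  (* Both flag waves, divided by their powers of e, are their leading parts up
     to errors rp and rq of size K2 e. *)
  pose rp := fp / e%:C ^+ w p - ap; pose rq := fq / e%:C ^+ w q - aq.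
  have rb (f a : R[i]) k : `|f - e%:C ^+ k * a| <= K2 * e%:C * e%:C ^+ k ->
      `|f / e%:C ^+ k - a| <= K2 * e%:C.
    move=> h; have -> : f / e%:C ^+ k - a = (f - e%:C ^+ k * a) / e%:C ^+ k.
      by rewrite mulrBl [_ * a]mulrC mulfK.
    by rewrite normrM normfV ler_pdivrMr ?normr_gt0 // [`|_ ^+ _|]ger0_norm ?exprn_ge0.
  have rpb : `|rp| <= K2 * e%:C by apply: rb.
  have rqb : `|rq| <= K2 * e%:C by apply: rb.
  have Ke : K2 * e%:C <= K2 by rewrite -[leRHS]mulr1 ler_wpM2l.
  have -> : fp * fq^*%R / (e%:C ^+ w p * e%:C ^+ w q) - ap * aq^*%R =
     rp * (aq + rq)^*%R + ap * rq^*%R.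
    have -> : aq + rq = fq / e%:C ^+ w q by rewrite /rq addrC subrK.
    have -> : rq^*%R = (fq / e%:C ^+ w q)^*%R - aq^*%R by rewrite rmorphB.
    have -> : (fq / e%:C ^+ w q)^*%R = fq^*%R / e%:C ^+ w q.
      by rewrite rmorphM fmorphV /= ec.
    by rewrite /rp; field; rewrite !en.
  apply: le_trans (ler_normD _ _) _; rewrite !normrM !norm_conjC.
  have -> : 3 * K2 ^+ 2 * e%:C = K2 * e%:C * (K2 + K2) + K2 * (K2 * e%:C) by ring.
  apply: lerD; last exact: ler_pM.
  apply: ler_pM => //; apply: le_trans (ler_normD _ _) _; apply: lerD => //.
  exact: le_trans Ke.
- apply/matrixP => p q; rewrite 2!mxE [B q p]mxE [B p q]mxE.
  rewrite rmorphM fmorphV rmorphM /= !ec [e%:C ^+ w q * _]mulrC; congr (_ / _).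
  by have /matrixP/(_ p q) := QDh; rewrite 2!mxE.
Qed.

End Graded.

(** * The spectrum *)

Section Spectrum.
Variables (R : realType) (d n m : nat) (y : 'I_n -> 'rV[R]_d).
Let r k := \rank (vandermonde_le y k).
Hypothesis rm : r m = n.
Let w (p : 'I_n) := level r m p.

Lemma taylor_coef_neq0 (a : {ffun 'I_d -> 'I_m.+1}) : taylor_coef R a != 0.
Proof.
rewrite mulf_neq0 ?expf_neq0 //; first by rewrite -normr_eq0 norm_i oner_neq0.
apply/prodf_neq0 => k _; by rewrite invr_eq0 pnatr_eq0 -lt0n fact_gt0.
Qed.

(** The leading polynomials are linearly independent: a dependency among them, restricted to
    its part of degree k, is a combination of vectors of level k orthogonal to the monomials
    of degree k. *)
Lemma leading_coef_inj (Q : 'M[R[i]]_n) :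
  (forall k (c : 'rV[R[i]]_n), (forall p, w p != k -> c 0 p = 0) ->
     (forall a, (\sum_i a i = k)%N ->
         \sum_p c 0 p * \sum_s Q p s * (monomial y a s)%:C = 0) ->
     c = 0) ->
  forall x : 'rV_n,
    (forall a, \sum_p x 0 p * leading_coef (m := m) y Q w p a = 0) -> x = 0.
Proof.
move=> Qinj x xl; apply/rowP => p0; rewrite [RHS]mxE.
(* Only basis vectors of level k have a leading polynomial of degree k, so the
   levels can be treated one at a time. *)
pose c : 'rV[R[i]]_n := \row_p (if w p == w p0 then x 0 p else 0).
have c0 : c = 0.
  apply: (Qinj (w p0)) => [p wp|a ak]; first by rewrite mxE (negPf wp).
  have am k : (a k < m.+1)%N.
    rewrite ltnS; apply: leq_trans (level_le rm (ltn_ord p0)).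
    by rewrite -/(w p0) -ak (bigD1 k) //= leq_addr.
  pose al : {ffun 'I_d -> 'I_m.+1} := [ffun k => Ordinal (am k)].
  have als : (\sum_k al k = w p0)%N by rewrite -ak; apply: eq_bigr => k _; rewrite ffunE.
  apply: (mulfI (taylor_coef_neq0 al)); rewrite mulr0 -[RHS](xl al) mulr_sumr.
  apply: eq_bigr => p _; rewrite mxE /leading_coef als eq_sym.
  case: eqP => _; last by rewrite mul0r !mulr0.
  rewrite mulrCA; congr (_ * (_ * _)); rewrite /flag_moment.
  apply: eq_bigr => s _; congr (_ * _%:C); rewrite /monomial.
  by apply: eq_bigr => k _; rewrite ffunE.
by have /rowP/(_ p0) := c0; rewrite !mxE eqxx.
Qed.

(** Exact scaling, with eigenvalues indexed by basis vectors. The constant C is uniform in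
    eps: for small eps it comes from the perturbation theorem, for large eps from the
    boundedness of the spectrum. *)
Lemma dirichlet_spectrum (P : R) : 0 <= P -> (forall s i, `|y s 0 i| <= P) ->
  exists (l : 'I_n -> R) (C : R), (forall p, 0 < l p) /\
  forall N (Delta : R), (0 < N)%N -> 0 < N%:R * Delta -> N%:R^-1 <= N%:R * Delta ->
  exists lam : 'I_n -> R,
    char_poly (dirichlet_matrix N (scaled Delta y)) = \prod_p ('X - ((lam p)%:C)%:P) /\
    forall p, scales_with (l p) C (N%:R * Delta) (w p) (lam p).
Proof.
move=> P0 yP.
have [Q Qu [Q0 Qinj]] := flag_basis rm.
have wm p : (w p <= m)%N := level_le rm (ltn_ord p).
have [K0 K00 HD] := dirichlet_graded Q0 wm P0 yP.
have [Kb Kb0 Hb] := dirichlet_eigen_bounded y.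
have Ggt0 := moment_gram_gt0 (leading_coef_inj Qinj).
have wh (p q : 'I_n) : (p <= q)%N -> (w p <= w q)%N.
  by move=> pq; exact: (level_homo rm pq (ltn_ord q)).
have [l l0 Hl] := graded_perturbation (moment_gram_herm _) Ggt0 wh.
have [K [e1 [K1 e10 HK]]] := Hl K0 K00.
have lR p : (complex.Re (l p))%:C = l p by rewrite RRe_real // gtr0_real.
have KR : (complex.Re K)%:C = K by rewrite RRe_real // gtr0_real.
have KbR : (complex.Re Kb)%:C = Kb by rewrite RRe_real // ger0_real.
have e1R : (complex.Re e1)%:C = e1 by rewrite RRe_real // gtr0_real.
pose lr p := complex.Re (l p).
have lr0 p : 0 < lr p by rewrite -ltcR lR.
pose e := Num.min (complex.Re e1) 1.
have e0 : 0 < e by rewrite lt_min ltr01 andbT -ltcR e1R.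
have ee1 : e <= 1 by rewrite ge_min lexx orbT.
have Kb0' : 0 <= complex.Re Kb by rewrite -lecR KbR.
have Kr0 : 0 < complex.Re K by rewrite -ltcR KR.
(* M bounds lam / ep ^ (2 w) - l when ep > e. There no smallness is left to
   prove: M <= (M / e) ep, because 0 <= lam <= Kb. *)
pose M := complex.Re Kb / e ^+ (2 * m) + \sum_p lr p.
have slr : 0 <= \sum_p lr p by rewrite sumr_ge0 // => p _; exact: ltW.
have M0 : 0 <= M by rewrite addr_ge0 // divr_ge0 // exprn_ge0 // ltW.
exists lr, (complex.Re K + M / e); split=> // N Delta N0 ep0 Ne.
set ep := N%:R * Delta in ep0 Ne *.
have epn k : ep ^+ k != 0 by rewrite expf_neq0 // gt_eqF.
have scale (lam : 'I_n -> R) p : `|lam p / ep ^+ (2 * w p) - lr p| <= (complex.Re K + M / e) * ep ->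
    scales_with (lr p) (complex.Re K + M / e) ep (w p) (lam p).
  move=> h; exists (lam p / ep ^+ (2 * w p) - lr p); split=> //.
  by rewrite addrC subrK mulrCA divff // mulr1.
have [epe|eep] := leP ep e.
  have ep1 : ep <= 1 := le_trans epe ee1.
  have [B [Bh BG QDQ]] : exists B : 'M[R[i]]_n, [/\ B^t* = B,
    forall p q, `|B p q - moment_gram (leading_coef (m := m) y Q w) p q| <= K0 * ep%:C &
    let E := grading w ep%:C in
    Q *m dirichlet_matrix N (scaled Delta y) *m Q^t* = E *m B *m E].
    by apply: HD; rewrite ?ep0.
  have epC : 0 < ep%:C <= e1.
    rewrite -[0]/(0%:C) ltcR ep0 -e1R lecR (le_trans epe) //.
    by rewrite ge_min lexx.
  have [lam clam lamb] := HK _ B epC Bh BG.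
  have lamr p : lam p \is Num.real by case: (lamb p).
  exists (fun p => complex.Re (lam p)); split.
    under eq_bigr do rewrite RRe_real //.
    rewrite -clam; apply: (char_poly_similar (unitarymx_unit Qu)).
    rewrite -QDQ -[_ *m _ *m Q]mulmxA unitarymxVP // mulmx1 //.
  move=> p; apply: (scale (fun p => complex.Re (lam p))).
  have h := (lamb p).2.
  rewrite -(RRe_real (lamr p)) -lR -KR -rmorphXn -!rmorphM -rmorphB in h.
  rewrite norm_real_complex lecR in h.
  have epw : 0 < ep ^+ (2 * w p) by rewrite exprn_gt0.
  rewrite -(ler_pM2r epw) -[X in _ * X <= _](gtr0_norm epw).
  rewrite -normrM mulrBl divfK // [lr p * _]mulrC; apply: le_trans h _.
  apply: ler_wpM2r; first exact: ltW.
  apply: ler_wpM2r; first exact: ltW.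
  by rewrite lerDl divr_ge0 // ltW.
have [lam clam lamb] := Hb N Delta N0.
have lamr p : lam p \is Num.real by rewrite ger0_real //; case/andP: (lamb p).
exists (fun p => complex.Re (lam p)); split.
  by under eq_bigr do rewrite RRe_real //.
move=> p; apply: (scale (fun p => complex.Re (lam p))).
have /andP[a1 a2] : 0 <= complex.Re (lam p) <= complex.Re Kb.
  by rewrite -!lecR RRe_real // KbR.
apply: (@le_trans _ _ M).
  apply: le_trans (ler_normB _ _) _; rewrite /M; apply: lerD.
    have h : e ^+ (2 * m) <= ep ^+ (2 * w p).
      apply: (@le_trans _ _ (e ^+ (2 * w p))).
        by apply: ler_wiXn2l; rewrite ?leq_mul2l ?wm //; exact: ltW.
      by apply: lerXn2r; rewrite ?nnegrE; exact: ltW.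
    rewrite ger0_norm; last by rewrite divr_ge0 // exprn_ge0 // ltW.
    apply: ler_pM => //; first by rewrite invr_ge0 exprn_ge0 // ltW.
    by rewrite lef_pV2 // posrE exprn_gt0.
  rewrite (gtr0_norm (lr0 p)) [leRHS](bigD1 p) //= lerDl sumr_ge0 // => q _; exact: ltW.
rewrite mulrDl -[leLHS]add0r; apply: lerD; first by rewrite mulr_ge0 // ltW.
by rewrite mulrAC ler_pdivlMr // ler_wpM2l // ltW.
Qed.

End Spectrum.

(** * Grouping the eigenvalues by level *)

Section Reindex.
Variables (r : nat -> nat) (m n : nat).
Hypothesis rm : r m = n.
Hypothesis r_mono : forall k l, (k <= l)%N -> (r k <= r l)%N.
Hypothesis r0 : r 0%N = 1%N.

Lemma level_eq p k : (p < r k)%N -> (k <= m)%N -> (r k.-1 <= p)%N || (k == 0%N) ->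
  level r m p = k.
Proof.
move=> pk km kp; have pn : (p < n)%N by rewrite -rm (leq_trans pk) // r_mono.
apply/eqP; rewrite eqn_leq; apply/andP; split; rewrite leqNgt; apply/negP => h.
  by have := level_lb rm pn h; rewrite leqNgt pk.
case: k {pk km} h kp => // k h; rewrite orbF /= => kp.
by have := level_ub rm pn; rewrite ltnNge (leq_trans _ kp) // r_mono.
Qed.

(** Cutting the range below r M at r 0 = 1, r 1, ..., r M. *)
Lemma prod_levels (F : comNzRingType) (f : nat -> F) M :
  \prod_(0 <= i < r M) f i =
  f 0%N * \prod_(1 <= k < M.+1) \prod_(1 <= j < (r k - r k.-1).+1) f (r k.-1 + j.-1)%N.
Proof.
elim: M => [|M IH]; first by rewrite r0 big_nat1 big_geq // mulr1.
rewrite (@big_cat_nat _ _ _ (r M)) //=; last exact: r_mono.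
rewrite IH [in RHS]big_nat_recr //= -mulrA; congr (_ * (_ * _)).
rewrite big_add1 /= -{1}[r M]add0n big_addn; apply: eq_bigr => j _.
by rewrite addnC.
Qed.

End Reindex.

Section Ranks.
Variables (R : realType) (d n : nat) (y : 'I_n -> 'rV[R]_d).

Lemma vandermonde_rank0 : (0 < n)%N -> \rank (vandermonde_le y 0) = 1%N.
Proof.
move=> n0; apply/eqP; rewrite eqn_leq; apply/andP; split.
  apply: leq_trans (rank_leq_col _) _; apply/card_le1_eqP => f g _ _.
  by apply/ffunP => i; rewrite !ord1.
rewrite lt0n mxrank_eq0 -trmx_eq0.
have h : (monomial_row y (fun=> 0%N) <= (vandermonde_le y 0)^T)%MS.
  by apply: monomial_row_sub; rewrite big1.
apply/eqP => v0; move: h; rewrite v0 => /submx0null/rowP/(_ (Ordinal n0)).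
rewrite !mxE /monomial big1 => [/eqP|i _]; last by rewrite expr0.
by rewrite oner_eq0.
Qed.

(** Scaling the nodes multiplies the column of exponent a by Delta ^+ |a|, so t_k is the same
    for X and for Y. *)
Lemma vandermonde_rank_scaled (Delta : R) k : Delta != 0 ->
  \rank (vandermonde_le (scaled Delta y) k) = \rank (vandermonde_le y k).
Proof.
move=> D0.
pose e (c : 'I_#|multi_index d k|) := (\sum_i (enum_val c : {ffun 'I_d -> 'I_k.+1}) i)%N.
have -> : vandermonde_le (scaled Delta y) k =
    vandermonde_le y k *m diag_mx (\row_c Delta ^+ e c).
  apply/matrixP => p c; rewrite mul_mx_diag !mxE /e -prodrXr -big_split /=.
  by apply: eq_bigr => i _; rewrite !mxE exprMn mulrC.
apply: mxrankMfree; rewrite row_free_unit unitmxE det_diag unitfE.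
by apply/prodf_neq0 => c _; rewrite mxE expf_neq0.
Qed.

End Ranks.

Theorem theorem5p3 (R : realType) (d n : nat) (y : 'I_n -> 'rV[R]_d) (m : nat)
  (d_gt0 : (0 < d)%N) (n_gt0 : (0 < n)%N)
  (y_inj : injective y)
  (y_box : forall p i, - pi <= y p 0 i < pi)
  (y_order : is_discrete_moment_order y m) :
  exists (ltilde : nat -> nat -> R) (C : R),
    (forall k j, ltilde k j != 0) /\
    forall eps0 alpha : R, 0 < eps0 -> 0 < alpha < 1 ->
    exists N0 : nat, forall (N : nat) (Delta : R),
      (0 < N)%N -> (N0 <= N)%N -> 0 < Delta < (2 * pi)^-1 ->
      alpha * eps0 < N%:R * Delta < eps0 ->
      let X := scaled Delta y in
      let t := rank_increment X in
      exists lambda : nat -> nat -> R,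
        char_poly (dirichlet_matrix N X) =
          ('X - ((lambda 0%N 0%N)%:C)%:P) *
          \prod_(1 <= k < m.+1) \prod_(1 <= j < (t k).+1)
             ('X - ((lambda k j)%:C)%:P) /\
        scales_with (ltilde 0%N 0%N) C (N%:R * Delta) 0 (lambda 0%N 0%N) /\
        (forall k j, (1 <= k <= m)%N -> (1 <= j <= t k)%N ->
           scales_with (ltilde k j) C (N%:R * Delta) k (lambda k j)).
Proof.
have [rm _] := y_order.
have yP s i : `|y s 0 i| <= pi :> R.
  by have /andP[h1 h2] := y_box s i; rewrite ler_norml h1 ltW.
have [l [C [l0 H]]] := dirichlet_spectrum rm (pi_ge0 R) yP.
pose r k := \rank (vandermonde_le y k).
have r_mono k k' : (k <= k')%N -> (r k <= r k')%N by exact: vandermonde_rank_mono.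
have r0 : r 0%N = 1%N by exact: vandermonde_rank0.
pose p0 := Ordinal n_gt0.
(* The eigenvalues of level k >= 1 occupy the positions r (k - 1), ..., r k - 1.
   Outside the range of the statement insubd falls back on position 0. *)
pose idx k j : 'I_n := insubd p0 (if k is k'.+1 then r k' + j.-1 else 0)%N.
exists (fun k j => l (idx k j)), C; split=> [k j|eps0 alpha eps00 /andP[al0 al1]].
  by rewrite gt_eqF.
have ae0 : 0 < alpha * eps0 by rewrite mulr_gt0.
(* For N >= N0 one has 1 / N <= alpha eps0 < N Delta. *)
exists (Num.bound (alpha * eps0)^-1) => N Delta N0 NN /andP[D0 D1] /andP[e1 e2] X t.
have N0' : 0 < N%:R :> R by rewrite ltr0n.
have ep0 : 0 < N%:R * Delta by rewrite mulr_gt0.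
have Ne : N%:R^-1 <= N%:R * Delta.
  apply: le_trans (ltW e1); rewrite -[leRHS]invrK lef_pV2 ?posrE ?invr_gt0 //.
  apply: le_trans (ltW (archi_boundP _)) _; first by rewrite invr_ge0 ltW.
  by rewrite ler_nat.
have [lam [clam lamb]] := H N Delta N0 ep0 Ne.
have tE k : t k = (r k - r k.-1)%N.
  by rewrite /t /rank_increment !vandermonde_rank_scaled ?gt_eqF.
exists (fun k j => lam (idx k j)); split; [|split].
- rewrite clam.
  pose f i : {poly R[i]} := 'X - ((lam (insubd p0 i))%:C)%:P.
  transitivity (\prod_(0 <= i < r m) f i).
    rewrite /r rm big_mkord; apply: eq_bigr => p _.
    by rewrite /f valKd.
  rewrite (prod_levels r_mono r0); congr (_ * _).
  apply: eq_big_nat => k /andP[k1 km]; rewrite tE; apply: eq_bigr => j _.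
  by rewrite /f /idx; case: k k1 {km}.
- have := lamb (idx 0%N 0%N); rewrite (_ : level _ _ _ = 0%N) //.
  by apply: (level_eq rm r_mono); rewrite //= val_insubd n_gt0 -/(r 0%N) ?r0.
- move=> k j /andP[k1 km] /andP[j1]; rewrite tE => jt.
  have := lamb (idx k j); rewrite (_ : level _ _ _ = k) //.
  have ik : (r k.-1 + j.-1 < r k)%N.
    by case: j j1 jt => // j _ jt; rewrite /= -ltn_subRL.
  have e : idx k j = (r k.-1 + j.-1)%N :> nat.
    rewrite /idx; case: k k1 km jt ik => // k _ km jt ik.
    by rewrite val_insubd /= -rm (leq_trans ik) // r_mono.
  apply: (level_eq rm r_mono) => //; first by rewrite e.
  by rewrite e leq_addr.
Qed.
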